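(* Suppose $V$ satisfies Assumption 1 (stated in the context) with constants $M,L,m>0$. Then, for all $s>0$, $$\sup_{\|f\|_{C^s}\le1}\ \inf_{\hat T_n}\ \sup_{\|\theta\|\le1}\|\hat T_n-f(\theta)\|_{L_2(\mathbb{P}_\theta)}\ \gtrsim_{m,M}\ \Bigl(\frac1{\sqrt n}\vee\Bigl(\sqrt{\frac dn}\Bigr)^s\Bigr)\wedge1,$$ where the infimum is taken over all estimators $\hat T_n=\hat T_n(X_1,\dots,X_n)$.
   Context: Notation. For $A,B\ge0$, $A\gtrsim_{m,M}B$ means that $A\ge CB$ for some constant $C>0$ that may depend on $m$ and $M$ (only). $a\wedge b=\min(a,b)$, $a\vee b=\max(a,b)$. $\|\cdot\|$ is the Euclidean norm of vectors and the operator norm of matrices and multilinear forms. Model. Let $n,d\ge 1$ be integers and let $V:\mathbb{R}^d\to\mathbb{R}$ be a (known) convex function with $\int e^{-V(x)}dx=1$. Put $P(dx)=e^{-V(x)}dx$ and $P_\theta(dx)=e^{-V(x-\theta)}dx$, $\theta\in\mathbb{R}^d$. Under $\mathbb{P}_\theta$, $X_1,\dots,X_n$ are i.i.d. with law $P_\theta$; $\xi$ denotes a random vector with law $P$. An estimator is any measurable real-valued function of $(X_1,\dots,X_n)$. $V',V''$ are the gradient and Hessian of $V$; $\mathcal{I}:=\mathbb{E}V'(\xi)\otimes V'(\xi)$ is the Fisher information matrix (under Assumption 1 it equals $\mathbb{E}V''(\xi)$). Assumption 1 (constants $M,L,m>0$): (i) $V$ is strictly convex and twice continuously differentiable with $\|V''\|_{L_\infty}=\sup_x\|V''(x)\|\le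 M$ and $\|V''\|_{\rm Lip}=\sup_{x\ne y}\|V''(x)-V''(y)\|/\|x-y\|\le L$; (ii) $\mathcal{I}\succeq mI_d$. Hölder norm: for $s=l+\rho$, $l\ge0$ an integer, $\rho\in(0,1]$, and $f:\mathbb{R}^d\to\mathbb{R}$ that is $l$ times differentiable, $\|f\|_{C^s}:=\max_{0\le j\le l}\sup_x\|f^{(j)}(x)\|\vee\sup_{x\neq y}\frac{\|f^{(l)}(x)-f^{(l)}(y)\|}{\|x-y\|^\rho}$.
   Formalization: The constant C is allowed to depend on s as well as on m and M; with a constant depending on m and M only, uniform over all s>0, the claim fails (Gaussian V, d=n, s=2k, with n and k tending to infinity). *)

(* Defs.v *)
From HB Require Import structures.
From mathcomp Require Import all_boot all_order all_algebra.
From mathcomp Require Import all_classical all_reals all_analysis.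
Set Implicit Arguments.
Unset Strict Implicit.
Unset Printing Implicit Defensive.
Import Order.TTheory GRing.Theory Num.Theory.
Import numFieldNormedType.Exports.
Local Open Scope classical_set_scope.
Local Open Scope ring_scope.

Definition measure_rV_display : measure_display -> measure_display.
Proof. exact. Qed.

(* Product sigma-algebra on row vectors, built exactly as the library does for
   [n.-tuple T]; for [T = R] these are the Borel sets of R^n. *)
Section measurable_rV.
Context {d} {T : measurableType d} {n : nat}.

Let coors : 'I_n -> 'rV[T]_n -> T := fun i x => x ord0 i.

Let rV_set0 : g_sigma_preimage coors set0.
Proof. exact: sigma_algebra0. Qed.

Let rV_setC A : g_sigma_preimage coors A -> g_sigma_preimage coors (~` A).
Proof. exact: sigma_algebraC. Qed.

Let rV_bigcup (F : _^nat) : (forall i, g_sigma_preimage coors (F i)) ->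
  g_sigma_preimage coors (\bigcup_i (F i)).
Proof. exact: sigma_algebra_bigcup. Qed.

HB.instance Definition _ := @isMeasurable.Build (measure_rV_display d)
  'rV[T]_n (g_sigma_preimage coors) rV_set0 rV_setC rV_bigcup.

End measurable_rV.

Section power_measure.
Context {R : realType} {dT} {T : measurableType dT} (mu : set T -> \bar R).
Local Open Scope ereal_scope.

Fixpoint power_measure (n : nat) : set (n.-tuple T) -> \bar R :=
  match n with
  | 0%N => dirac [tuple]
  | n'.+1 => pushforward (mu \x @power_measure n')
               (fun p : T * n'.-tuple T => [tuple of p.1 :: p.2])
  end.

End power_measure.
Arguments power_measure {R dT T} mu n _.

Section measures.
Context {R : realType}.
Local Open Scope ereal_scope.

Definition lebesgue_rV (d : nat) : set 'rV[R]_d -> \bar R :=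
  pushforward (power_measure lebesgue_measure d)
    (fun t : d.-tuple R => \row_i tnth t i).

Definition location_law (d : nat) (V : 'rV[R]_d -> R) (theta : 'rV[R]_d)
    : set 'rV[R]_d -> \bar R :=
  fun A => \int[@lebesgue_rV d]_(x in A) (expR (- V (x - theta)%R))%:E.

Definition L2norm {dT} {T : measurableType dT} (mu : set T -> \bar R)
    (g : T -> R) : \bar R :=
  (\int[mu]_x (`|g x| ^+ 2)%:E) `^ 2^-1.

End measures.
Arguments lebesgue_rV {R} d _.
Arguments location_law {R d} V theta _.

Section calculus.
Context {R : realType} {d : nat}.
Implicit Types (f V : 'rV[R]_d -> R) (x y u v theta : 'rV[R]_d).

(* Euclidean norm; the library norm on [rV] is the sup norm. *)
Definition enorm x : R := Num.sqrt (\sum_i x ord0 i ^+ 2).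

Definition mx_opnorm (A : 'M[R]_d) : \bar R :=
  ereal_sup [set (enorm (u *m A))%:E | u in [set u | enorm u <= 1]].

Definition form_opnorm (j : nat) (B : j.-tuple 'rV[R]_d -> R) : \bar R :=
  ereal_sup [set `|B v|%:E |
    v in [set v : j.-tuple 'rV[R]_d | forall i, enorm (tnth v i) <= 1]].

(* In finite dimension a derivative, as a map into linear forms, is
   differentiable iff its value on every fixed vector is. *)
Fixpoint ndifferentiable (k : nat) f : Prop :=
  if k is k'.+1 then
    (forall x, differentiable f x) /\
    (forall v, ndifferentiable k' (fun x => 'D_v f x))
  else True.

(* f^(j)(x)(v_1, ..., v_j) = D_(v_1) ... D_(v_j) f (x) *)
Definition nderiv (j : nat) f x (v : j.-tuple 'rV[R]_d) : R :=
  foldr (fun w (g : 'rV[R]_d -> R) => (fun y => 'D_w g y)) f v x.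

Definition gradient V x : 'rV[R]_d := \row_i 'D_(delta_mx ord0 i) V x.

Definition hessian V x : 'M[R]_d :=
  \matrix_(i, j) 'D_(delta_mx ord0 i) (fun y => 'D_(delta_mx ord0 j) V y) x.

Definition strictly_convex V : Prop :=
  forall x y (t : R), x != y -> 0 < t -> t < 1 ->
    V (t *: x + (1 - t) *: y) < t * V x + (1 - t) * V y.

Definition loewner_le (A B : 'M[R]_d) : Prop :=
  forall u, (u *m A *m u^T) ord0 ord0 <= (u *m B *m u^T) ord0 ord0.

Definition fisher V : 'M[R]_d :=
  \matrix_(i, j) fine (\int[location_law V 0]_x
    (gradient V x ord0 i * gradient V x ord0 j)%:E)%E.

Definition location_model V : Prop :=
  convex_function [set: 'rV[R]_d] V /\
  (\int[lebesgue_rV d]_x (expR (- V x))%:E = 1)%E.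

Definition assumption1 (M L m : R) V : Prop :=
  [/\ strictly_convex V,
      ndifferentiable 2 V /\ continuous (hessian V),
      (ereal_sup [set mx_opnorm (hessian V x) | x in [set: 'rV[R]_d]]
         <= M%:E)%E,
      (ereal_sup [set mx_opnorm (hessian V p.1 - hessian V p.2)%R
                        * ((enorm (p.1 - p.2))^-1)%:E |
                  p in [set p : 'rV[R]_d * 'rV[R]_d | p.1 != p.2]]
         <= L%:E)%E
    & loewner_le m%:M (fisher V)].

(* The C^s norm for s = l + rho with 0 < rho <= 1. *)
Definition holder_norm (l : nat) (rho : R) f : \bar R :=
  maxe
    (\big[maxe/0%E]_(j < l.+1)
       ereal_sup [set form_opnorm (nderiv f x : j.-tuple _ -> R) |
                  x in [set: 'rV[R]_d]])
    (ereal_sup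
       [set (form_opnorm (fun v : l.-tuple 'rV[R]_d =>
                            nderiv f p.1 v - nderiv f p.2 v)%R
               * ((enorm (p.1 - p.2) `^ rho)^-1)%:E)%E |
        p in [set p : 'rV[R]_d * 'rV[R]_d | p.1 != p.2]]).

Definition holder_ball (l : nat) (rho : R) : set ('rV[R]_d -> R) :=
  [set f | ndifferentiable l f /\ (holder_norm l rho f <= 1)%E].

Definition sample_law (n : nat) V theta : set (n.-tuple 'rV[R]_d) -> \bar R :=
  power_measure (location_law V theta) n.

Definition estimator (n : nat) : set (n.-tuple 'rV[R]_d -> R) :=
  [set T | measurable_fun [set: n.-tuple 'rV[R]_d] T].

Definition worst_risk (n : nat) V f (T : n.-tuple 'rV[R]_d -> R) : \bar R :=
  ereal_sup [set L2norm (sample_law V theta) (fun X => T X - f theta) |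
             theta in [set theta | enorm theta <= 1]].

Definition minimax_risk (n : nat) V f : \bar R :=
  ereal_inf [set worst_risk V f T | T in @estimator n].

End calculus.

(* Main.v *)
(* The rate [(d / n) ^ (s / 2)] comes from [N >= 2 ^ (d / 2)] points [theta_i]
   of a ball of radius [r ~ sqrt (d / n)], pairwise at distance at least [r / 4].
   Put disjoint bumps of width [r / 8] and height [r ^ s] at these points, with
   arbitrary signs: for two distinct points, half of the [2 ^ N] resulting
   functions separate them, so good estimators of all of these functions would
   together identify the true [theta_i].

   They cannot, because a Hessian bounded by [M] gives
     [(1 - t) V (x - theta_i) + t V (x - theta_0) <= V (x - theta') + t M r ^ 2 / 2],
   [theta' = (1 - t) theta_i + t theta_0]: the weighted geometric mean of the
   joint densities [P_i] and [P_0] is at least [exp (- t n M r ^ 2 / 2)] times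
   the joint density at [theta'], and no integrability of the gradient of [V] is
   needed. With [t = 1 / (2 d)] this factor is close to 1. On the disjoint sets
   where [theta_i] is identified, the geometric mean is at most
   [N ^ (- t) ((1 - t) P_i + t N P_0)], of average mass at most
   [N ^ (- t) <= 2 ^ (- 1 / 4)]; so the identification fails with probability
   bounded below.

   The rate [1 / sqrt n] follows from the same argument for two points at
   distance [~ 1 / sqrt n] on the slope of a single bump of width 1. *)
Require Import Defs.
From HB Require Import structures.
From mathcomp Require Import all_boot all_order all_algebra.
From mathcomp Require Import all_classical all_reals all_analysis.
From mathcomp Require Import measurable_realfun ring lra zify.
Import Order.TTheory GRing.Theory Num.Theory.
Import numFieldNormedType.Exports.
Local Open Scope classical_set_scope.
Local Open Scope ring_scope.

(** * Powers of measures and densities *)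

(** Set functions such as [power_measure] carry no measure structure. Equalities with a bundled
    measure, as produced here, are rewritten with below so that the integration theorems apply. *)
Lemma sigma_finite_pack d (T : measurableType d) (R : realType)
    (m : {measure set T -> \bar R}) : sigma_finite setT m ->
  exists nu : {sigma_finite_measure set T -> \bar R},
    m = nu :> (set T -> \bar R).
Proof.
move=> sf.
pose H1 := isSFinite.Build _ _ _ _ (sfinite_measure_sigma_finite sf).
pose H2 := isSigmaFinite.Build _ _ _ _ sf.
pose nu := HB.pack_for (SigmaFiniteMeasure.type T R) (Measure.sort m) H1 H2.
by exists nu.
Qed.

(** The left inverse [g] transports the exhausting sets: the preimages of the [A n] under [g] cover
    the target, and pulling them back by [f] gives the [A n] again. *)
Lemma sigma_finite_pushforward d1 d2 (T1 : measurableType d1)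
    (T2 : measurableType d2) (R : realType)
    (mu : {measure set T1 -> \bar R}) (f : T1 -> T2) (g : T2 -> T1) :
  sigma_finite setT mu ->
  measurable_fun setT f -> measurable_fun setT g -> cancel f g ->
  exists nu : {sigma_finite_measure set T2 -> \bar R},
    pushforward mu f = nu.
Proof.
move=> [A AT Afin] mf mg fK.
have [m mE] : exists m : {measure set T2 -> \bar R},
    pushforward mu f = m :> (set T2 -> \bar R).
  by unshelve (eexists (pushforward mu f : {measure set T2 -> \bar R})).
rewrite mE; apply: sigma_finite_pack.
exists (fun n => g @^-1` A n).
  by rewrite -preimage_bigcup -AT preimage_setT.
move=> n; have [mA muA] := Afin n; split.
  by rewrite -[X in measurable X]setTI; exact: mg.
suff -> : m (g @^-1` A n) = mu (A n) by [].
by rewrite -mE /pushforward; congr (mu _); apply/seteqP; split=> x /=; rewrite fK.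
Qed.

Lemma sigma_finite_product d1 d2 (T1 : measurableType d1)
    (T2 : measurableType d2) (R : realType)
    (m1 : {sigma_finite_measure set T1 -> \bar R})
    (m2 : {sigma_finite_measure set T2 -> \bar R}) :
  sigma_finite setT (m1 \x m2)%E.
Proof.
have /sigma_finiteP[F [TF ndF Foo]] := sigma_finiteT m1.
have /sigma_finiteP[G [TG ndG Goo]] := sigma_finiteT m2.
exists (fun n => F n `*` G n) => [|k].
  rewrite -setXTT TF TG predeqE => -[x y]; split=> [[/= [n _ Fx] [k _ Gy]]|].
    exists (maxn n k) => //; split.
    - by move: x Fx; exact/subsetPset/ndF/leq_maxl.
    - by move: y Gy; exact/subsetPset/ndG/leq_maxr.
  by move=> [n _ []/= ? ?]; split; exists n.
have [mF finF] := Foo k; have [mG finG] := Goo k.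
split; first exact: measurableX.
by rewrite product_measure1E// lte_mul_pinfty// ge0_fin_numE.
Qed.

Section power_measure_theory.
Context {R : realType} {dT} {T : measurableType dT}.
Implicit Types mu : {sigma_finite_measure set T -> \bar R}.
Local Open Scope ereal_scope.

Lemma measurable_tuple_cons n :
  measurable_fun [set: T * n.-tuple T]
    (fun p : T * n.-tuple T => [tuple of p.1 :: p.2]).
Proof. exact: measurable_cons. Qed.

Lemma sigma_finite_power_measure mu n :
  exists nu : {sigma_finite_measure set (n.-tuple T) -> \bar R},
    power_measure mu n = nu.
Proof.
elim: n => [|n [nu IH]]; first by exists (dirac [tuple] : {finite_measure set _ -> \bar R}).
rewrite /= IH.
apply: (@sigma_finite_pushforward _ _ (T * n.-tuple T)%type
  (n.+1.-tuple T) R _ (fun p => [tuple of p.1 :: p.2])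
  (fun t => (thead t, [tuple of behead t]))).
- exact: sigma_finite_product.
- exact: measurable_tuple_cons.
- apply: measurable_fun_pair; last exact: measurable_behead.
  exact: measurable_tnth.
- by move=> [x t] /=; congr (_, _); apply/val_inj.
Qed.

Lemma integral_power_measure0 mu (g : 0.-tuple T -> \bar R) :
  measurable_fun [set: _.-tuple T] g -> (forall t, 0 <= g t) ->
  \int[power_measure mu 0]_t g t = g [tuple].
Proof. by move=> mg g0; rewrite /= integral_dirac// diracT mul1e. Qed.

Lemma integral_power_measureS mu n (g : n.+1.-tuple T -> \bar R) :
  measurable_fun [set: _.-tuple T] g -> (forall t, 0 <= g t) ->
  \int[power_measure mu n.+1]_t g t =
  \int[mu]_x \int[power_measure mu n]_t g [tuple of x :: t].
Proof.
move=> mg g0; rewrite /=.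
have [nu ->] := sigma_finite_power_measure mu n.
rewrite (ge0_integral_pushforward (measurable_tuple_cons n)) ?preimage_setT//.
rewrite (fubini_tonelli1 (g \o (fun p : T * n.-tuple T => [tuple of p.1 :: p.2])))//.
- by apply: measurableT_comp => //; exact: measurable_tuple_cons.
- by move=> x; exact: g0.
Qed.

Lemma measurable_integral_power_measure mu n (g : n.+1.-tuple T -> \bar R) :
  measurable_fun [set: _.-tuple T] g -> (forall t, 0 <= g t) ->
  measurable_fun setT (fun x => \int[power_measure mu n]_t g [tuple of x :: t]).
Proof.
move=> mg g0; have [nu ->] := sigma_finite_power_measure mu n.
apply: (measurable_fun_fubini_tonelli_F
  (g \o (fun p : T * n.-tuple T => [tuple of p.1 :: p.2]))) => //.
  by apply: measurableT_comp => //; exact: measurable_tuple_cons.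
by move=> x; exact: g0.
Qed.

Lemma measurable_tuple_consl n (x : T) :
  measurable_fun [set: n.-tuple T] (fun t => [tuple of x :: t]).
Proof. exact: measurable_cons. Qed.

End power_measure_theory.

Section density.
Context {R : realType} {dT} {T : measurableType dT}.
Variables (mu : {sigma_finite_measure set T -> \bar R}) (p : T -> R).
Hypotheses (mp : measurable_fun [set: T] p) (p0 : forall x, 0 <= p x).
Local Open Scope ereal_scope.

Definition density_law : set T -> \bar R :=
  fun A => \int[mu]_(x in A) (p x)%:E.

Let mEp D : measurable_fun D (EFin \o p).
Proof. by apply/measurable_EFinP; exact: measurable_funTS. Qed.

Let density_law0 : density_law set0 = 0.
Proof. by rewrite /density_law integral_set0. Qed.

Let density_law_ge0 A : 0 <= density_law A.
Proof. by apply: integral_ge0 => x _; rewrite lee_fin. Qed.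

Let density_law_sigma_additive : semi_sigma_additive density_law.
Proof.
move=> F mF tF mUF; rewrite /density_law ge0_integral_bigcup//; last first.
  by move=> x _; rewrite lee_fin.
apply: is_cvg_ereal_nneg_natsum_cond => n _ _.
by apply: integral_ge0 => x _; rewrite lee_fin.
Qed.

HB.instance Definition _ := isMeasure.Build _ _ _ density_law
  density_law0 density_law_ge0 density_law_sigma_additive.

Lemma sigma_finite_density_law : \int[mu]_x (p x)%:E < +oo ->
  exists P : {sigma_finite_measure set T -> \bar R}, density_law = P.
Proof.
move=> fin; apply: sigma_finite_pack; exists (fun=> setT).
  by rewrite bigcup_const//; exists 0%N.
by move=> _; split.
Qed.

Import HBNNSimple.

Let integral_density_indic E : measurable E ->
  \int[density_law]_x (\1_E x)%:E = \int[mu]_x ((\1_E x)%:E * (p x)%:E).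
Proof.
move=> mE; rewrite integral_indic//= setIT [LHS]integral_mkcond/=.
apply: eq_integral => x _; rewrite patchE indicE.
by case: ifPn => _; rewrite ?mul1e ?mul0e.
Qed.

Let integral_density_nnsfun (f : {nnsfun T >-> R}) :
  \int[density_law]_x (f x)%:E = \int[mu]_x ((f x)%:E * (p x)%:E).
Proof.
under [LHS]eq_integral do rewrite fimfunE -fsumEFin//.
rewrite [LHS]ge0_integral_fsum//; last 2 first.
  - by move=> r; exact/measurable_EFinP/measurableT_comp.
  - by move=> n x _; rewrite EFinM nnfun_muleindic_ge0.
under [RHS]eq_integral.
  move=> x xD; rewrite fimfunE -fsumEFin// ge0_mule_fsuml; last first.
    by move=> r; rewrite EFinM nnfun_muleindic_ge0.
  over.
rewrite [RHS]ge0_integral_fsum//; last 2 first.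
  - move=> r; apply: emeasurable_funM => //.
    by apply/measurable_EFinP/measurableT_comp.
  - move=> n x _; rewrite mule_ge0//; last by rewrite lee_fin.
    by rewrite EFinM nnfun_muleindic_ge0.
apply: eq_fsbigr => r; rewrite inE => -[y _ fyr].
have r0 : (0 <= r)%R by rewrite -fyr.
under eq_integral do rewrite EFinM.
under [RHS]eq_integral do rewrite EFinM -muleA.
rewrite ge0_integralZl//; last exact/measurable_EFinP/measurable_indic.
rewrite integral_density_indic// ge0_integralZl//.
- by apply: emeasurable_funM => //; exact/measurable_EFinP/measurable_indic.
- by move=> x _; rewrite mule_ge0// lee_fin.
Qed.

(** The identity holds for indicators, hence for simple functions; monotone convergence along
    [nnsfun_approx] gives the general case. *)
Lemma integral_density_law (f : T -> \bar R) :
  measurable_fun setT f -> (forall x, 0 <= f x) ->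
  \int[density_law]_x f x = \int[mu]_x (f x * (p x)%:E).
Proof.
move=> mf f0.
pose f_ := nnsfun_approx measurableT mf.
transitivity (lim (\int[density_law]_x (f_ n x)%:E @[n --> \oo])).
  rewrite -monotone_convergence//=.
  - apply: eq_integral => ? /[!inE] xD; apply/esym/cvg_lim => //=.
    exact: cvg_nnsfun_approx.
  - by move=> n; exact/measurable_EFinP/measurable_funTS.
  - by move=> n ? _; rewrite lee_fin.
  - by move=> ? _ ? ? mn; rewrite lee_fin; exact/lefP/nd_nnsfun_approx.
under eq_fun do rewrite integral_density_nnsfun.
rewrite -monotone_convergence//=.
- apply: eq_integral => x _; apply/cvg_lim => //=.
  apply: cvgeZr => //; exact: cvg_nnsfun_approx.
- move=> n; apply: emeasurable_funM => //.
  exact/measurable_EFinP/measurable_funTS.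
- by move=> n x _; rewrite mule_ge0// lee_fin.
- move=> x _ a b ab; rewrite lee_wpmul2r// ?lee_fin//.
  exact/lefP/nd_nnsfun_approx.
Qed.

End density.
Arguments density_law {R dT T} mu p _.

Section power_measure_change.
Context {R : realType} {dT} {T : measurableType dT}.
Variable mu : {sigma_finite_measure set T -> \bar R}.
Local Open Scope ereal_scope.

Lemma measurable_prod_tnth (p : T -> R) n : measurable_fun setT p ->
  measurable_fun [set: n.-tuple T] (fun t => \prod_(i < n) p (tnth t i))%R.
Proof.
move=> mp; apply: measurable_prod => i _.
by apply: measurableT_comp => //; exact: measurable_tnth.
Qed.

(** The density of a product law is the product of the densities; Tonelli's theorem peels off one
    factor at a time. *)
Lemma integral_power_density_law (p : T -> R) :
  measurable_fun setT p -> (forall x, 0 <= p x)%R ->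
  \int[mu]_x (p x)%:E < +oo ->
  forall n (g : n.-tuple T -> \bar R),
  measurable_fun [set: _.-tuple T] g -> (forall t, 0 <= g t) ->
  \int[power_measure (density_law mu p) n]_t g t =
  \int[power_measure mu n]_t (g t * (\prod_(i < n) p (tnth t i))%:E).
Proof.
move=> mp p0 fin; have [P PE] := sigma_finite_density_law mu p mp p0 fin.
have prod0 k (t : k.-tuple T) : 0 <= (\prod_(i < k) p (tnth t i))%:E.
  by rewrite lee_fin prodr_ge0.
have mprod k : measurable_fun [set: k.-tuple T]
    (fun t => (\prod_(i < k) p (tnth t i))%:E).
  by apply/measurable_EFinP; exact: measurable_prod_tnth.
elim=> [|n IH] g mg g0.
  rewrite PE !integral_power_measure0//.
  - by rewrite big_ord0 mule1.
  - by apply: emeasurable_funM => //; exact: mprod.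
  - by move=> t; rewrite mule_ge0.
have mgc x : measurable_fun [set: n.-tuple T] (fun t => g [tuple of x :: t]).
  by apply: measurableT_comp => //; exact: measurable_tuple_consl.
rewrite PE (integral_power_measureS _ _ _ mg g0) -PE.
rewrite (integral_density_law _ _ mp p0); last 2 first.
- rewrite PE; exact: measurable_integral_power_measure.
- by rewrite PE; have [nu ->] := sigma_finite_power_measure P n => x; apply: integral_ge0.
rewrite integral_power_measureS; last 2 first.
- by apply: emeasurable_funM => //; exact: mprod.
- by move=> t; rewrite mule_ge0.
apply: eq_integral => x _; rewrite IH//.
have [nu ->] := sigma_finite_power_measure mu n.
rewrite -ge0_integralZr//; last 3 first.
- by apply: emeasurable_funM => //; exact: mprod.
- by move=> t _; rewrite mule_ge0.
- by rewrite lee_fin.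
apply: eq_integral => t _; rewrite -muleA -EFinM; congr (_ * _%:E).
rewrite big_ord_recl tnth0 mulrC; congr (_ * _)%R.
by apply: eq_bigr => i _; rewrite tnthS.
Qed.

Lemma integral_power_density1 (p : T -> R) :
  measurable_fun setT p -> (forall x, 0 <= p x)%R ->
  \int[mu]_x (p x)%:E = 1 -> forall n,
  \int[power_measure mu n]_t (\prod_(i < n) p (tnth t i))%:E = 1.
Proof.
move=> mp p0 p1; elim=> [|n IH].
  rewrite integral_power_measure0.
  - by rewrite big_ord0.
  - by apply/measurable_EFinP; exact: measurable_prod_tnth.
  - by move=> t; rewrite lee_fin prodr_ge0.
rewrite integral_power_measureS; last 2 first.
- by apply/measurable_EFinP; exact: measurable_prod_tnth.
- by move=> t; rewrite lee_fin prodr_ge0.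
rewrite -[RHS]p1; apply: eq_integral => x _.
rewrite -[RHS]mule1 -IH.
have [nu ->] := sigma_finite_power_measure mu n.
rewrite -ge0_integralZl//.
- apply: eq_integral => t _; rewrite -EFinM big_ord_recl tnth0.
  by congr (_ * _)%:E; apply: eq_bigr => i _; rewrite tnthS.
- by apply/measurable_EFinP; exact: measurable_prod_tnth.
- by move=> t _; rewrite lee_fin prodr_ge0.
- by rewrite lee_fin.
Qed.

(** Each coordinate has its own map, so that translation by a vector, which moves every coordinate
    by a different amount, is covered. *)
Lemma integral_power_invariant n (f : 'I_n -> T -> T) :
  (forall i, measurable_fun setT (f i)) ->
  (forall i (g : T -> \bar R), measurable_fun setT g -> (forall x, 0 <= g x) ->
     \int[mu]_x g (f i x) = \int[mu]_x g x) ->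
  forall g : n.-tuple T -> \bar R,
  measurable_fun [set: _.-tuple T] g -> (forall t, 0 <= g t) ->
  \int[power_measure mu n]_t g [tuple f i (tnth t i) | i < n] =
  \int[power_measure mu n]_t g t.
Proof.
elim: n f => [|n IH] f mf fmu g mg g0.
  by apply: eq_integral => t _; congr (g _); apply: eq_from_tnth => -[].
have mmap k (h : 'I_k -> T -> T) : (forall i, measurable_fun setT (h i)) ->
    measurable_fun [set: k.-tuple T] (fun t => [tuple h i (tnth t i) | i < k]).
  move=> mh; apply/measurable_fun_tnthP => i.
  rewrite [X in measurable_fun _ X](_ : _ = h i \o (@tnth k T)^~ i).
    by apply: measurableT_comp => //; exact: measurable_tnth.
  by apply/funext => t; rewrite /= tnth_mktuple.
rewrite (integral_power_measureS _ _ _ mg g0) integral_power_measureS; last 2 first.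
- by apply: (@measurableT_comp _ _ _ _ _ _ g) => //; exact: mmap.
- by move=> t; exact: g0.
have mgc x : measurable_fun [set: n.-tuple T] (fun t => g [tuple of x :: t]).
  by apply: measurableT_comp => //; exact: measurable_tuple_consl.
rewrite -[RHS](fmu ord0); last 2 first.
- exact: measurable_integral_power_measure.
- by have [nu ->] := sigma_finite_power_measure mu n => x; apply: integral_ge0.
apply: eq_integral => x _.
have /= <- := IH _ (fun i => mf (lift ord0 i)) (fun i => fmu (lift ord0 i))
  (fun t => g [tuple of f ord0 x :: t]) (mgc _) (fun t => g0 _).
have [nu ->] := sigma_finite_power_measure mu n.
apply: eq_integral => t _; congr (g _); apply: eq_from_tnth => i.
rewrite tnth_mktuple; case: (unliftP ord0 i) => [j ->|->].
  by rewrite !tnthS tnth_mktuple.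
by rewrite !tnth0.
Qed.

End power_measure_change.

(** * Lebesgue measure on row vectors *)

Lemma measurable_addr_const (R : realType) (a : R) :
  measurable_fun [set: measurableTypeR R]
    ((fun x : R => x + a) : measurableTypeR R -> measurableTypeR R).
Proof. by apply: measurable_funD => //; exact: measurable_id. Qed.

(** Lebesgue measure is determined by its values on half-open intervals, and translation preserves
    their lengths. *)
Lemma lebesgue_measure_translate (R : realType) (a : R)
    (g : measurableTypeR R -> \bar R) :
  measurable_fun [set: measurableTypeR R] g -> (forall x, 0 <= g x)%E ->
  (\int[@lebesgue_measure R]_x g (x + a)%R = \int[@lebesgue_measure R]_x g x)%E.
Proof.
move=> mg g0.
pose f : measurableTypeR R -> measurableTypeR R := fun x : R => x + a.
have mf : measurable_fun setT f by exact: measurable_addr_const.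
have <- : (\int[pushforward (@lebesgue_measure R) f]_x g x =
  \int[@lebesgue_measure R]_x g (x + a)%R)%E.
  rewrite (ge0_integral_pushforward mf _ measurableT mg) ?preimage_setT; first by [].
  by move=> y _; exact: g0.
apply: eq_measure_integral => A mA _.
symmetry; apply: lebesgue_measure_unique => // _ [[u v] _ <-] /=.
rewrite /= /pushforward.
have -> : f @^-1` `]u, v]%classic = `]u - a, v - a]%classic.
  by apply/seteqP; split=> x /=; rewrite !in_itv /f/= ltrBlDr lerBrDr.
rewrite !lebesgue_measure_itv/= !lte_fin ltrD2r; case: ifPn => // _.
by congr (_%:E); ring.
Qed.

Section row_vectors.
Context {R : realType} (d : nat).
Local Notation row_of := (fun t : d.-tuple R => \row_i tnth t i).

Lemma measurable_coord_rV dT (T : measurableType dT) (i : 'I_d) :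
  measurable_fun [set: 'rV[T]_d] (fun x : 'rV[T]_d => x ord0 i).
Proof.
move=> _ Y mY; rewrite setTI; apply: sub_sigma_algebra => /=.
rewrite -bigcup_seq/=; exists i => /=; first by rewrite mem_index_enum.
by exists Y => //; rewrite setTI.
Qed.

Lemma measurable_fun_rV dX (X : measurableType dX) dT (T : measurableType dT)
    (f : X -> 'rV[T]_d) :
  (forall i, measurable_fun [set: X] (fun x => f x ord0 i)) ->
  measurable_fun [set: X] f.
Proof.
move=> mf.
apply: (@measurability _ _ _ _ _ _
  (\big[setU/set0]_(i < d) preimage_set_system setT
     (fun x : 'rV[T]_d => x ord0 i) measurable)) => //.
move=> _ [B + <-]; rewrite -bigcup_seq => -[i _ [C mC <-]].
by rewrite setTI -comp_preimage; exact: (mf i).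
Qed.

Lemma measurable_row_of_tuple :
  measurable_fun [set: d.-tuple (measurableTypeR R)]
    (row_of : _ -> 'rV[R]_d).
Proof.
apply: measurable_fun_rV => i; under eq_fun do rewrite mxE.
exact: measurable_tnth.
Qed.

Lemma measurable_tuple_of_row :
  measurable_fun [set: 'rV[R]_d]
    (fun x => [tuple x ord0 i | i < d] : d.-tuple (measurableTypeR R)).
Proof.
apply/measurable_fun_tnthP => i.
rewrite [X in measurable_fun _ X](_ : _ = fun x : 'rV[R]_d => x ord0 i).
  exact: measurable_coord_rV.
by apply/funext => x; rewrite /= tnth_mktuple.
Qed.

Lemma sigma_finite_lebesgue_rV :
  exists nu : {sigma_finite_measure set 'rV[R]_d -> \bar R}, @lebesgue_rV R d = nu.
Proof.
rewrite /lebesgue_rV.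
have [nu ->] := sigma_finite_power_measure (@lebesgue_measure R) d.
have := @sigma_finite_pushforward _ _ _ _ _ _ _ _ (sigma_finiteT nu)
  (@measurable_row_of_tuple) (@measurable_tuple_of_row).
apply => t.
by apply: eq_from_tnth => i; rewrite tnth_mktuple mxE.
Qed.

Lemma integral_lebesgue_rV (g : 'rV[R]_d -> \bar R) :
  measurable_fun [set: 'rV[R]_d] g -> (forall x, 0 <= g x)%E ->
  (\int[@lebesgue_rV R d]_x g x =
   \int[power_measure (@lebesgue_measure R) d]_t g (\row_i tnth t i))%E.
Proof.
move=> mg g0; rewrite /lebesgue_rV.
have [nu ->] := sigma_finite_power_measure (@lebesgue_measure R) d.
rewrite ge0_integral_pushforward//; exact: measurable_row_of_tuple.
Qed.

Lemma measurable_translate (a : 'rV[R]_d) :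
  measurable_fun [set: 'rV[R]_d] (fun x : 'rV[R]_d => x - a).
Proof.
apply: measurable_fun_rV => i; under eq_fun do rewrite mxE.
apply: measurable_funD => //; exact: measurable_coord_rV.
Qed.

Lemma integral_lebesgue_rV_translate (a : 'rV[R]_d) (g : 'rV[R]_d -> \bar R) :
  measurable_fun [set: 'rV[R]_d] g -> (forall x, 0 <= g x)%E ->
  (\int[@lebesgue_rV R d]_x g (x - a)%R = \int[@lebesgue_rV R d]_x g x)%E.
Proof.
move=> mg g0; rewrite !integral_lebesgue_rV//; last first.
  by apply: (@measurableT_comp _ _ _ _ _ _ g) => //; exact: measurable_translate.
have mgr : measurable_fun [set: d.-tuple (measurableTypeR R)]
    (fun t => g (\row_i tnth t i)).
  by apply: (@measurableT_comp _ _ _ _ _ _ g) => //; exact: measurable_row_of_tuple.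
rewrite -[RHS](@integral_power_invariant _ _ _ (@lebesgue_measure R) d
  (fun i x => (x - a ord0 i)%R) _ _ _ mgr) //; last 2 first.
- by move=> i; exact: (measurable_addr_const R (- a ord0 i)%R).
- by move=> i h mh h0; exact: (lebesgue_measure_translate R (- a ord0 i)%R).
have [nu ->] := sigma_finite_power_measure (@lebesgue_measure R) d.
apply: eq_integral => t _; congr (g _); apply/rowP => i.
by rewrite !mxE tnth_mktuple.
Qed.

End row_vectors.

(** The sigma-algebra on rows is generated by the coordinates, the topology by the sup norm. An open
    set is the union of the countably many rational cubes [box q] that it contains. *)
Lemma open_measurable_rV (R : realType) d (U : set 'rV[R]_d) :
  open U -> measurable U.
Proof.
move=> oU.
pose box (q : 'rV[rat]_d * rat) : set 'rV[R]_d :=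
  \bigcap_(i in [set: 'I_d]) [set x | `|x ord0 i - ratr (q.1 ord0 i)| < ratr q.2].
pose F q := if `[< box q `<=` U >] then box q else set0.
have -> : U = \bigcup_q F q.
  apply/seteqP; split=> [x Ux|x [q _]]; last by rewrite /F; case: asboolP => // qU /qU.
  have /nbhs_ballP[e /= e0 eU] := open_nbhs_nbhs (conj oU Ux).
  (* With a radius below [e / 2], a cube containing [x] stays within [e] of it. *)
  have [r] := @rat_in_itvoo R 0 (e / 2) ltac:(lra).
  rewrite in_itv/= => /andP[r0 re].
  have /choice[q qP] (i : 'I_d) : exists q : rat, `|x ord0 i - ratr q| < ratr r.
    have [q] := @rat_in_itvoo R (x ord0 i - ratr r) (x ord0 i + ratr r) ltac:(lra).
    rewrite in_itv/= => /andP[q1 q2]; exists q; rewrite ltr_norml; lra.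
  have xq : box (\row_i q i, r) x by move=> i _ /=; rewrite mxE.
  exists (\row_i q i, r) => //; rewrite /F; case: asboolP => // -[] y yq.
  apply: eU; split => // i j; rewrite (ord1 i) {i}.
  suff : `|x ord0 j - y ord0 j| < e by [].
  have := yq j I; have := xq j I; rewrite /= !ltr_norml.
  by move=> /andP[? ?] /andP[? ?]; apply/andP; split; lra.
apply: countable_bigcupT_measurable => [|q]; first exact: countableP.
rewrite /F; case: asboolP => // _.
apply: fin_bigcap_measurable => // i _.
rewrite -[X in measurable X]setTI.
have mf : measurable_fun [set: 'rV[R]_d]
    (fun x : 'rV[R]_d => `|x ord0 i - ratr (q.1 ord0 i)|).
  apply: measurableT_comp => //; apply: measurable_funB => //.
  exact: measurable_coord_rV.
have := mf measurableT `]-oo, ratr q.2[%classic (measurable_itv _).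
by congr measurable; apply/seteqP; split=> x /=; rewrite in_itv.
Qed.

Lemma continuous_measurable_rV (R : realType) d (f : 'rV[R]_d -> R) :
  continuous f -> measurable_fun [set: 'rV[R]_d] f.
Proof.
move=> cf; apply: (measurability _ (RGenOpens.measurableE R)) => _ [_ [a [b ->] <-]].
rewrite setTI; apply: open_measurable_rV.
by apply: open_comp; [move=> x _; exact: cf|exact: interval_open].
Qed.

Lemma measurable_location_density (R : realType) d (V : 'rV[R]_d -> R) theta :
  continuous V ->
  measurable_fun [set: 'rV[R]_d] (fun x => expR (- V (x - theta))).
Proof.
move=> cV; do 2 apply: measurableT_comp => //.
apply: (@measurableT_comp _ _ _ _ _ _ V); first exact: continuous_measurable_rV.
exact: measurable_translate.
Qed.

(** The dominating measure [nu] is chosen before [theta]: the likelihoods of all parameters can then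
    be compared pointwise in the sample. *)
Lemma sample_law_density (R : realType) d (V : 'rV[R]_d -> R) n :
  continuous V -> (\int[lebesgue_rV d]_x (expR (- V x))%:E = 1)%E ->
  exists nu : {sigma_finite_measure set (n.-tuple 'rV[R]_d) -> \bar R},
  forall theta,
    (\int[nu]_t (\prod_(i < n) expR (- V (tnth t i - theta)))%:E = 1)%E /\
    forall g : n.-tuple 'rV[R]_d -> \bar R,
    measurable_fun [set: n.-tuple 'rV[R]_d] g -> (forall t, 0 <= g t)%E ->
    (\int[sample_law V theta]_t g t =
     \int[nu]_t (g t * (\prod_(i < n) expR (- V (tnth t i - theta)))%:E))%E.
Proof.
move=> cV V1.
have [mu muE] := @sigma_finite_lebesgue_rV R d.
have [nu nuE] := sigma_finite_power_measure mu n; exists nu => theta.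
have mp := measurable_location_density R d V theta cV.
have p0 x : 0 <= expR (- V (x - theta)) by exact: expR_ge0.
have p1 : (\int[mu]_x (expR (- V (x - theta)))%:E = 1)%E.
  rewrite -muE (integral_lebesgue_rV_translate _ theta (fun x => (expR (- V x))%:E))//.
  apply/measurable_EFinP; have := measurable_location_density R d V 0 cV.
  by congr measurable_fun; apply/funext => x; rewrite subr0.
split; first by rewrite -nuE; exact: (integral_power_density1 mu _ mp p0 p1).
move=> g mg g0; rewrite -nuE.
rewrite /sample_law; have -> : location_law V theta =
    density_law mu (fun x => expR (- V (x - theta))).
  by rewrite /location_law muE.
by rewrite (integral_power_density_law _ _ mp p0)// p1 ltry.
Qed.

(** * Indistinguishable hypotheses *)

Section information.
Context {R : realType}.
Implicit Types (lam u v A B : R).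

(** The tangent to the exponential at the weighted mean [w] lies below its graph; the claim is the
    weighted sum of two tangent inequalities. *)
Lemma expR_weighted_AMGM lam u v : 0 <= lam <= 1 ->
  expR ((1 - lam) * u + lam * v) <= (1 - lam) * expR u + lam * expR v.
Proof.
move=> /andP[l0 l1]; set w := (1 - lam) * u + lam * v.
have tan z : expR w * (1 + (z - w)) <= expR z.
  have -> : expR z = expR w * expR (z - w) by rewrite -expRD subrKC.
  by rewrite ler_wpM2l ?expR_ge0// expR_ge1Dx.
apply: (@le_trans _ _ ((1 - lam) * (expR w * (1 + (u - w))) +
    lam * (expR w * (1 + (v - w))))).
  by rewrite le_eqVlt; apply/orP; left; apply/eqP; rewrite /w; ring.
by rewrite lerD// ler_wpM2l// subr_ge0.
Qed.

(** Weighted AM-GM after [exp (- B)] is multiplied by [N], a factor repaid by [N ^ (- lam)] in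
    front. This serves for the hypothesis that the sample identifies. *)
Lemma expR_geometric_mean_card lam A B (N : R) : 0 <= lam <= 1 -> 0 < N ->
  expR (- ((1 - lam) * A + lam * B)) <=
  expR (- (lam * ln N)) * ((1 - lam) * expR (- A) + lam * N * expR (- B)).
Proof.
move=> l01 N0.
have -> : lam * N * expR (- B) = lam * expR (- B + ln N).
  by rewrite expRD lnK// -mulrA [N * _]mulrC.
have -> : - ((1 - lam) * A + lam * B) =
    - (lam * ln N) + ((1 - lam) * - A + lam * (- B + ln N)) by ring.
by rewrite expRD ler_wpM2l ?expR_ge0// expR_weighted_AMGM.
Qed.

(** This serves for the hypotheses that are not identified: the weight of [exp (- B)] becomes small
    at the cost of a large weight on [exp (- A)], which the estimation error pays for. *)
Lemma expR_geometric_mean_scale lam A B : 0 < lam <= 2^-1 ->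
  expR (- ((1 - lam) * A + lam * B)) <= 16 * expR (- A) + 32^-1 * expR (- B).
Proof.
move=> /andP[l0 l2]; pose c : R := ln 16.
have ec : expR c = 16 by rewrite lnK// posrE.
have c0 : 0 <= c by rewrite ln_ge0//; lra.
(* Raising [- A] by [ln 16] and lowering [- B] by [ln 16 * (1 - lam) / lam] leaves the mean
   unchanged. Since [lam <= 1 / 2], the second shift is at least [ln 16], whence a weight of at most
   [lam / 16 <= 1 / 32]. *)
have -> : - ((1 - lam) * A + lam * B) =
    (1 - lam) * (c - A) + lam * (- B - c * ((1 - lam) / lam)).
  by field; rewrite gt_eqF.
apply: (le_trans (expR_weighted_AMGM lam _ _ _)); first by apply/andP; split; lra.
rewrite !expRD ec lerD//.
  rewrite -[leRHS]mul1r ler_wpM2r// ?mulr_ge0 ?expR_ge0//; lra.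
have : expR (- (c * ((1 - lam) / lam))) <= 16^-1.
  rewrite -ec -expRN ler_expR lerN2 -[leLHS]mulr1 ler_wpM2l//.
  by rewrite ler_pdivlMr// mul1r; lra.
have := expR_ge0 (- B); set b := expR (- B); set e := expR _ => b0 e16.
rewrite mulrCA mulrC; apply: ler_wpM2r => //.
have e0 : 0 <= e by exact: expR_ge0.
nra.
Qed.

(* [85 / 100 >= 2 ^ (- 1 / 4)]. *)
Lemma expR_card_le D (N : R) : (0 < D)%N -> 0 < N -> 2 ^+ D <= N ^+ 2 ->
  expR (- ((2 * D%:R)^-1 * ln N)) <= 85 / 100.
Proof.
move=> D0 N0 DN.
have D0' : (0 : R) < D%:R by rewrite ltr0n.
have k0 : (0 < 4 * D)%N by rewrite muln_gt0.
have y0 : 0 <= 85 / 100 :> R by lra.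
(* The power [4 D] turns the claim into [N ^ (- 2) <= (85 / 100) ^ (4 D)], and
   [(85 / 100) ^ 4 >= 1 / 2]. *)
rewrite -(ler_pXn2r k0) ?nnegrE ?expR_ge0//.
rewrite -expRM_natl.
have -> : (4 * D)%:R * - ((2 * D%:R)^-1 * ln N) = 2%:R * - ln N.
  by rewrite natrM; field; rewrite gt_eqF.
rewrite expRM_natl expRN lnK// exprVn.
apply: (@le_trans _ _ ((2 ^+ D)^-1)).
  by rewrite lef_pV2// posrE ?exprn_gt0.
rewrite -exprVn exprM; apply: lerXn2r; rewrite ?nnegrE; lra.
Qed.

End information.

Section information_lower_bound.
Context {R : realType} (I : finType).

(** For a fixed sample, [A i], [B] and [Abar i] stand for the negative log-likelihoods at [theta_i],
    [theta_0] and the point between them, and [E i] for the squared error at [theta_i]. By [Esep] at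
    most one index has error below [eta2]. Only that one gets the bound with the factor [N], so
    [lam * N] spreads over all indices as [lam] each. *)
Lemma hypothesis_pointwise_bound (D : nat) (lam eta2 B : R)
    (A Abar E : I -> R) :
  (0 < D)%N -> lam = (2 * D%:R)^-1 -> 0 < eta2 ->
  2 ^+ D <= #|I|%:R ^+ 2 :> R ->
  (forall i, (1 - lam) * A i + lam * B <= Abar i + 20^-1) ->
  (forall i, 0 <= E i) ->
  (forall i j, i != j -> 2 * eta2 <= E i + E j) ->
  19 / 20 * \sum_i expR (- Abar i) <=
  \sum_i (85 / 100 * (1 - lam) * expR (- A i) +
          16 / eta2 * (E i * expR (- A i)) +
          (85 / 100 * lam + 32^-1) * expR (- B)).
Proof.
move=> D0 lamE eta0 DI AB E0 Esep.
have D1 : (1 : R) <= D%:R by rewrite ler1n.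
have lam0 : 0 < lam by rewrite lamE invr_gt0; lra.
have lam2 : lam <= 2^-1 by rewrite lamE lef_pV2 ?posrE; lra.
have lam01 : 0 <= lam <= 1 by apply/andP; split; lra.
have lam02 : 0 < lam <= 2^-1 by apply/andP; split; lra.
have b0 : 0 <= expR (- B) by exact: expR_ge0.
have N0 : 0 < #|I|%:R :> R.
  rewrite ltr0n lt0n; apply/eqP => I0; move: DI; rewrite I0 expr0n/=.
  by apply/negP; rewrite -ltNge exprn_gt0.
set N := (X in 0 < X) in N0 *.
have y85 : expR (- (lam * ln N)) <= 85 / 100 by rewrite lamE; exact: expR_card_le.
have N1 : \sum_i (E i < eta2)%R%:R <= 1 :> R.
  have [/existsP[i0 Ei0]|/existsPn none] := boolP [exists i, E i < eta2].
    rewrite (bigD1 i0)//= Ei0 big1 ?addr0// => i ii0.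
    have := Esep i i0 ii0; case: ltP => // Ei; lra.
  by rewrite big1// => i _; rewrite (negbTE (none i)).
apply: (@le_trans _ _ (\sum_i (85 / 100 * (1 - lam) * expR (- A i) +
   16 / eta2 * (E i * expR (- A i)) + 32^-1 * expR (- B) +
   (E i < eta2)%R%:R * (85 / 100 * (lam * N * expR (- B)))))).
  rewrite mulr_sumr; apply: ler_sum => i _.
  have a0 : 0 <= expR (- A i) by exact: expR_ge0.
  (* The slack [1 / 20] of [AB] costs the factor [exp (- 1 / 20) >= 19 / 20]. *)
  have X1 : 19 / 20 * expR (- Abar i) <= expR (- ((1 - lam) * A i + lam * B)).
    apply: (@le_trans _ _ (expR (- 20^-1 - Abar i))).
      rewrite expRD ler_wpM2r ?expR_ge0//.
      by have := @expR_ge1Dx R (- 20^-1); lra.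
    by rewrite ler_expR; have := AB i; lra.
  apply: (le_trans X1).
  have EA0 : 0 <= 16 / eta2 * (E i * expR (- A i)).
    by rewrite mulr_ge0 ?divr_ge0 ?mulr_ge0//; lra.
  case: ltP => Ei; rewrite ?mul1r ?mul0r ?addr0.
    apply: (le_trans (expR_geometric_mean_card lam _ _ N lam01 N0)).
    have Z0 : 0 <= (1 - lam) * expR (- A i) + lam * N * expR (- B).
      by rewrite addr_ge0 ?mulr_ge0//; lra.
    have := ler_wpM2r Z0 y85; lra.
  apply: (le_trans (expR_geometric_mean_scale lam _ _ lam02)).
  rewrite lerD// -[leLHS]add0r lerD//.
    by rewrite !mulr_ge0//; lra.
  (* An error of at least [eta2] pays for the term [16 * exp (- A i)]. *)
  have : 1 <= E i / eta2 by rewrite ler_pdivlMr ?mul1r.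
  move=> /(ler_wpM2r (_ : 0 <= 16 * expR (- A i))).
  by rewrite mul1r mulr_ge0// => /(_ isT) /le_trans; apply; rewrite le_eqVlt;
    apply/orP; left; apply/eqP; ring.
rewrite big_split/= -mulr_suml; set Z := 85 / 100 * (lam * N * expR (- B)).
have Z0 : 0 <= Z by rewrite /Z !mulr_ge0//; lra.
have ZE : Z = \sum_(i : I) 85 / 100 * lam * expR (- B).
  by rewrite sumr_const -mulr_natl /Z /N; ring.
have := ler_wpM2r Z0 N1; rewrite mul1r => N1Z; apply: (le_trans (lerD (lexx _) N1Z)).
by rewrite ZE -big_split/=; apply: ler_sum => i _; lra.
Qed.

Context d (X : measurableType d) (nu : {measure set X -> \bar R}).

Lemma integral_sum_EFin (h : I -> X -> R) :
  (forall i, measurable_fun setT (h i)) -> (forall i x, 0 <= h i x) ->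
  (\int[nu]_x (\sum_i h i x)%:E = \sum_i \int[nu]_x (h i x)%:E)%E.
Proof.
move=> mh h0; under eq_integral do rewrite -sumEFin.
rewrite ge0_integral_sum// => [i|i x _]; first exact/measurable_EFinP.
by rewrite lee_fin.
Qed.

Lemma integralZl_EFin_ge0 (c : R) (h : X -> R) : 0 <= c ->
  measurable_fun setT h -> (forall x, 0 <= h x) ->
  (\int[nu]_x (c * h x)%:E = c%:E * \int[nu]_x (h x)%:E)%E.
Proof.
move=> c0 mh h0; under eq_integral do rewrite EFinM.
rewrite ge0_integralZl_EFin// => [x _|]; first by rewrite lee_fin.
exact/measurable_EFinP.
Qed.

(** All densities have mass one, so integrating the pointwise bound gives
    [19 / 20 <= a + b * tau2 + c] with [a + c = 85 / 100 + 1 / 32]. The remaining gap, above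
    [65 / 1000], must come from [b * tau2 = 16 * tau2 / eta2]. *)
Lemma hypothesis_lower_bound (D : nat) (lam eta2 tau2 : R) (B : X -> R)
    (A Abar E : I -> X -> R) :
  (0 < D)%N -> lam = (2 * D%:R)^-1 -> 0 < eta2 ->
  2 ^+ D <= #|I|%:R ^+ 2 :> R ->
  (forall i x, (1 - lam) * A i x + lam * B x <= Abar i x + 20^-1) ->
  (forall i x, 0 <= E i x) ->
  (forall i j x, i != j -> 2 * eta2 <= E i x + E j x) ->
  measurable_fun setT B -> (forall i, measurable_fun setT (A i)) ->
  (forall i, measurable_fun setT (Abar i)) ->
  (forall i, measurable_fun setT (E i)) ->
  (\int[nu]_x (expR (- B x))%:E = 1)%E ->
  (forall i, \int[nu]_x (expR (- A i x))%:E = 1)%E ->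
  (forall i, \int[nu]_x (expR (- Abar i x))%:E = 1)%E ->
  (forall i, \int[nu]_x (E i x * expR (- A i x))%:E <= tau2%:E)%E ->
  eta2 <= 256 * tau2.
Proof.
move=> D0 lamE eta0 DI AB E0 Esep mB mA mAbar mE B1 A1 Abar1 Etau.
have D1 : (1 : R) <= D%:R by rewrite ler1n.
have lam0 : 0 < lam by rewrite lamE invr_gt0; lra.
have lam2 : lam <= 2^-1 by rewrite lamE lef_pV2 ?posrE; lra.
have mexp (h : X -> R) : measurable_fun setT h ->
    measurable_fun setT (fun x => expR (- h x)).
  by move=> mh; do 2 apply: measurableT_comp => //.
have mEA i : measurable_fun setT (fun x => E i x * expR (- A i x)).
  by apply: measurable_funM => //; exact: mexp.
have EA0 i x : 0 <= E i x * expR (- A i x) by rewrite mulr_ge0// expR_ge0.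
pose a := 85 / 100 * (1 - lam); pose b := 16 / eta2.
pose c := 85 / 100 * lam + 32^-1.
have a0 : 0 <= a by rewrite /a mulr_ge0//; lra.
have b0 : 0 <= b by rewrite /b divr_ge0//; lra.
have c0 : 0 <= c by rewrite /c; lra.
pose h i x := a * expR (- A i x) + b * (E i x * expR (- A i x)) + c * expR (- B x).
have mh i : measurable_fun setT (h i).
  by apply: measurable_funD; [apply: measurable_funD|];
    apply: measurable_funM => //; exact: mexp.
have h0 i x : 0 <= h i x.
  by rewrite /h !addr_ge0//; apply: mulr_ge0 => //; rewrite expR_ge0.
have N0 : 0 < #|I|%:R :> R.
  rewrite ltr0n lt0n; apply/eqP => I0; move: DI; rewrite I0 expr0n/=.
  by apply/negP; rewrite -ltNge exprn_gt0.
have hle i : (\int[nu]_x (h i x)%:E <= (a + b * tau2 + c)%:E)%E.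
  rewrite /h; under eq_integral do rewrite EFinD.
  rewrite ge0_integralD//; first last.
  - by apply/measurable_EFinP; apply: measurable_funM => //; exact: mexp.
  - by move=> x _; rewrite lee_fin mulr_ge0// expR_ge0.
  - apply/measurable_EFinP; apply: measurable_funD; apply: measurable_funM => //.
    exact: mexp.
  - by move=> x _; rewrite lee_fin addr_ge0// mulr_ge0// expR_ge0.
  under eq_integral do rewrite EFinD.
  rewrite ge0_integralD//; first last.
  - by apply/measurable_EFinP; apply: measurable_funM.
  - by move=> x _; rewrite lee_fin mulr_ge0.
  - by apply/measurable_EFinP; apply: measurable_funM => //; exact: mexp.
  - by move=> x _; rewrite lee_fin mulr_ge0// expR_ge0.
  rewrite !integralZl_EFin_ge0//; try (by move=> x; rewrite expR_ge0); try exact: mexp.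
  rewrite A1 B1 !mule1 !EFinD.
  do 2 apply: leeD => //; rewrite (EFinM b).
  by apply: lee_wpmul2l => //; rewrite lee_fin.
have : ((19 / 20 * #|I|%:R)%:E <= (#|I|%:R * (a + b * tau2 + c))%:E)%E.
  apply: (@le_trans _ _ (\int[nu]_x (\sum_i h i x)%:E)%E); last first.
    rewrite integral_sum_EFin//.
    apply: (@le_trans _ _ (\sum_(i : I) (a + b * tau2 + c)%:E)%E).
      by apply: lee_sum => i _; exact: hle.
    by rewrite sumEFin sumr_const mulr_natl.
  apply: (@le_trans _ _ (\int[nu]_x (19 / 20 * \sum_i expR (- Abar i x))%:E)%E).
    rewrite integralZl_EFin_ge0//; first last.
    - by move=> x; apply: sumr_ge0 => i _; rewrite expR_ge0.
    - by apply: measurable_sum => i; exact: mexp.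
    rewrite (integral_sum_EFin (fun i x => expR (- Abar i x))); last 2 first.
    - by move=> i; exact: mexp.
    - by move=> i x; exact: expR_ge0.
    rewrite (eq_bigr (fun=> 1%:E)) => [|i _]; last exact: Abar1.
    by rewrite sumEFin -EFinM sumr_const.
  apply: ge0_le_integral => //.
  - move=> x _; rewrite lee_fin mulr_ge0//.
    by apply: sumr_ge0 => i _; rewrite expR_ge0.
  - apply/measurable_EFinP; apply: measurable_funM => //.
    by apply: measurable_sum => i; exact: mexp.
  - by apply/measurable_EFinP; exact: measurable_sum.
  - move=> x _; rewrite lee_fin.
    by apply: (@hypothesis_pointwise_bound D) => // i j; exact: Esep.
rewrite lee_fin [leLHS]mulrC ler_pM2l// /a /c => main.
have {}main : 65 / 1000 <= b * tau2 by lra.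
have : 65 / 1000 * eta2 <= b * tau2 * eta2 by rewrite ler_wpM2r// ltW.
have -> : b * tau2 * eta2 = 16 * tau2 by rewrite /b; field; rewrite gt_eqF.
lra.
Qed.

End information_lower_bound.

(** * Euclidean norm and Hessian bounds *)

Section euclidean_norm.
Context {R : realType} {d : nat}.
Implicit Types (x y w : 'rV[R]_d) (c : R).

Lemma enorm_ge0 x : 0 <= enorm x.
Proof. exact: sqrtr_ge0. Qed.

Lemma enorm_sqr x : enorm x ^+ 2 = \sum_i x ord0 i ^+ 2.
Proof. by rewrite /enorm sqr_sqrtr// sumr_ge0// => i _; rewrite sqr_ge0. Qed.

Lemma enorm0 : enorm (0 : 'rV[R]_d) = 0.
Proof.
rewrite /enorm big1 ?sqrtr0// => i _.
by rewrite mxE expr0n.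
Qed.

Lemma enormZ c x : enorm (c *: x) = `|c| * enorm x.
Proof.
rewrite /enorm -sqrtr_sqr -sqrtrM ?sqr_ge0//; congr Num.sqrt.
by rewrite mulr_sumr; apply: eq_bigr => i _; rewrite mxE exprMn.
Qed.

Lemma enormN x : enorm (- x) = enorm x.
Proof. by rewrite -scaleN1r enormZ normrN1 mul1r. Qed.

Lemma enorm_gt0 x : x != 0 -> 0 < enorm x.
Proof.
move=> x0; rewrite lt_def enorm_ge0 andbT; apply: contra x0 => /eqP e0.
apply/eqP/rowP => i; rewrite mxE; apply/eqP; rewrite -sqrf_eq0.
have : \sum_i x ord0 i ^+ 2 = 0 by rewrite -enorm_sqr e0 expr0n.
by move/eqP; rewrite psumr_eq0 => [/allP/(_ i (mem_index_enum _))|j _]; rewrite ?sqr_ge0.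
Qed.

(** Cauchy-Schwarz, from the nonnegativity of the squared norm of [|y| ^ 2 x - S y], where [S] is
    the inner product. *)
Lemma dot_le_enorm x y :
  `|\sum_i x ord0 i * y ord0 i| <= enorm x * enorm y.
Proof.
have [->|/enorm_gt0 y0] := eqVneq y 0.
  rewrite enorm0 mulr0 big1 ?normr0// => i _.
  by rewrite mxE mulr0.
set S := \sum_i _.
have key : 0 <= enorm y ^+ 2 * (enorm x ^+ 2 * enorm y ^+ 2 - S ^+ 2).
  have : 0 <= \sum_i (enorm y ^+ 2 * x ord0 i - S * y ord0 i) ^+ 2.
    by apply: sumr_ge0 => i _; rewrite sqr_ge0.
  congr (0 <= _).
  under eq_bigr => i _.
    have -> : (enorm y ^+ 2 * x ord0 i - S * y ord0 i) ^+ 2 =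
     enorm y ^+ 4 * x ord0 i ^+ 2 - (2 * enorm y ^+ 2 * S) * (x ord0 i * y ord0 i)
     + S ^+ 2 * y ord0 i ^+ 2 by ring.
    over.
  rewrite big_split sumrB/= -!mulr_sumr -/S -!enorm_sqr; ring.
rewrite pmulr_rge0 ?exprn_gt0// subr_ge0 -exprMn in key.
rewrite -(ler_pXn2r (n := 2))// ?nnegrE ?mulr_ge0 ?enorm_ge0//.
by rewrite real_normK ?num_real.
Qed.

Lemma enormD x y : enorm (x + y) <= enorm x + enorm y.
Proof.
rewrite -(ler_pXn2r (n := 2))// ?nnegrE ?addr_ge0 ?enorm_ge0//.
have -> : enorm (x + y) ^+ 2 =
    enorm x ^+ 2 + 2 * \sum_i x ord0 i * y ord0 i + enorm y ^+ 2.
  rewrite !enorm_sqr mulr_sumr -!big_split/=; apply: eq_bigr => i _.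
  by rewrite mxE; ring.
have := le_trans (ler_norm _) (dot_le_enorm x y).
by rewrite sqrrD; lra.
Qed.

Lemma enormB_sym x y : enorm (x - y) = enorm (y - x).
Proof. by rewrite -enormN opprB. Qed.

End euclidean_norm.

(** * Directional derivatives and semiconcavity along segments *)

Section second_order.
Context {R : realType} {d : nat}.
Implicit Types (f V : 'rV[R]_d -> R) (x y w : 'rV[R]_d).

Lemma is_derive_line f x w (t : R) : derivable f (x + t *: w) w ->
  is_derive t 1 (fun t : R => f (x + t *: w)) ('D_w f (x + t *: w)).
Proof.
have E : (fun h : R => h^-1 *: (((fun t : R => f (x + t *: w)) \o shift t) (h *: 1)
      - f (x + t *: w))) =
    (fun h : R => h^-1 *: ((f \o shift (x + t *: w)) (h *: w) - f (x + t *: w))).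
  apply/funext => h /=; congr (_ *: (f _ - _)).
  by rewrite [h *: 1]mulr1 scalerDl addrCA.
by move=> df; split; rewrite /derivable/derive E.
Qed.

Lemma derive_coord f x w : differentiable f x ->
  'D_w f x = \sum_i w ord0 i * 'D_(delta_mx ord0 i) f x.
Proof.
move=> df; rewrite deriveE// {1}(row_sum_delta w) linear_sum/=.
by apply: eq_bigr => i _; rewrite linearZ/= deriveE.
Qed.

Lemma derive2_hessian V x w : ndifferentiable 2 V ->
  'D_w (fun y => 'D_w V y) x = (w *m hessian V x *m w^T) ord0 ord0.
Proof.
move=> [dV d2V].
have dj j y : differentiable (fun y => 'D_(delta_mx ord0 j) V y) y.
  by have [] := d2V (delta_mx ord0 j).
have -> : (fun y => 'D_w V y) =
    \sum_j (w ord0 j \*: (fun y => 'D_(delta_mx ord0 j) V y)).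
  by apply/funext => y; rewrite derive_coord// fct_sumE.
rewrite derive_sum; last first.
  by move=> i; apply: derivableZ; exact: diff_derivable.
rewrite mxE; apply: eq_bigr => j _.
rewrite deriveZ; last exact: diff_derivable.
rewrite derive_coord// mxE [w^T _ _]mxE /GRing.scale/= mulrC; congr (_ * _).
by apply: eq_bigr => i _; rewrite [hessian _ _ _ _]mxE.
Qed.

Lemma quadratic_form_le (A : 'M[R]_d) (M : R) w :
  (mx_opnorm A <= M%:E)%E -> (w *m A *m w^T) ord0 ord0 <= M * enorm w ^+ 2.
Proof.
move=> AM; have [->|w0] := eqVneq w 0.
  by rewrite !mul0mx mxE enorm0 expr0n mulr0.
have n0 := enorm_gt0 _ w0.
pose u := (enorm w)^-1 *: w.
have u1 : enorm u <= 1.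
  by rewrite enormZ ger0_norm ?invr_ge0 ?enorm_ge0// mulVf// gt_eqF.
have uA : enorm (u *m A) <= M.
  rewrite -lee_fin; apply: le_trans AM; apply: ereal_sup_ubound.
  by exists u.
have wA : enorm (w *m A) <= M * enorm w.
  have -> : w *m A = enorm w *: (u *m A).
    by rewrite scalemxAl scalerA mulfV ?scale1r// gt_eqF.
  by rewrite enormZ ger0_norm ?enorm_ge0// mulrC ler_wpM2r// enorm_ge0.
rewrite mxE; apply: le_trans (ler_norm _) _.
apply: (@le_trans _ _ (enorm (w *m A) * enorm w)).
  apply: le_trans (dot_le_enorm _ _); under eq_bigr do rewrite [w^T _ _]mxE.
  by [].
by rewrite expr2 mulrA ler_wpM2r// enorm_ge0.
Qed.

(** Subtracting [C t ^ 2 / 2] makes [phi] concave. The mean value theorem on either side of [lam]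
    gives slopes at points [a <= b]; applied to [dg] on [[a, b]], it shows that the slopes
    decrease. *)
Lemma semiconcave_line (phi dphi d2phi : R -> R) (C lam : R) :
  0 <= lam <= 1 ->
  (forall t : R, is_derive t 1 phi (dphi t)) ->
  (forall t : R, is_derive t 1 dphi (d2phi t)) ->
  (forall t, d2phi t <= C) ->
  (1 - lam) * phi 0 + lam * phi 1 <= phi lam + lam * (1 - lam) * C / 2.
Proof.
move=> /andP[l0 l1] d1 d2 dC.
have cont (g dg : R -> R) a b : (forall t : R, is_derive t 1 g (dg t)) ->
    {within `[a, b], continuous g}.
  move=> dg'; apply: continuous_subspaceT => t.
  by apply: differentiable_continuous; apply/derivable1_diffP; have [] := dg' t.
pose g t := phi t - C / 2 * t ^+ 2.
pose dg t := dphi t - C * t.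
have gd (t : R) : is_derive t 1 g (dg t).
  have := is_deriveB (d1 t) (is_deriveZ (C / 2) (is_deriveX 2 (is_derive_id t 1))).
  rewrite (_ : phi - _ = g); last by apply/funext => z; rewrite /g !fctE.
  by congr is_derive; rewrite /dg /GRing.scale/=; field.
have dgd (t : R) : is_derive t 1 dg (d2phi t - C).
  have := is_deriveB (d2 t) (is_deriveZ C (is_derive_id t 1)).
  by congr is_derive; rewrite /GRing.scale/= mulr1.
have [a al ga] := MVT_segment l0 (fun t _ => gd t) (cont _ _ _ _ gd).
have [b bl gb] := MVT_segment l1 (fun t _ => gd t) (cont _ _ _ _ gd).
have ab : a <= b.
  by move: al bl; rewrite !in_itv/= => /andP[_ +] /andP[+ _]; exact: le_trans.
have [c _ gc] := MVT_segment ab (fun t _ => dgd t) (cont _ _ _ _ dgd).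
have dgab : dg b <= dg a.
  rewrite -subr_le0 gc; apply: mulr_le0_ge0; last by rewrite subr_ge0.
  by rewrite subr_le0.
have : lam * (1 - lam) * (dg b - dg a) <= 0.
  by rewrite mulr_ge0_le0 ?mulr_ge0 ?subr_ge0// subr_le0.
have -> : lam * (1 - lam) * (dg b - dg a) =
   lam * (g 1 - g lam) - (1 - lam) * (g lam - g 0) by rewrite ga gb; ring.
rewrite /g; lra.
Qed.

(** Along the segment from [x] to [y], the second derivative of [V] is a value of the Hessian form,
    at most [M * |y - x| ^ 2]. *)
Lemma hessian_semiconcave V (M lam : R) x y : 0 <= lam <= 1 ->
  ndifferentiable 2 V ->
  (ereal_sup [set mx_opnorm (hessian V x) | x in [set: 'rV[R]_d]] <= M%:E)%E ->
  (1 - lam) * V x + lam * V y <=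
  V ((1 - lam) *: x + lam *: y) + lam * (1 - lam) * (M * enorm (y - x) ^+ 2) / 2.
Proof.
move=> l01 dV HM; set w := y - x.
have [dV1 dV2] := dV.
have := @semiconcave_line (fun t => V (x + t *: w))
  (fun t => 'D_w V (x + t *: w)) (fun t => 'D_w (fun z => 'D_w V z) (x + t *: w))
  (M * enorm w ^+ 2) lam l01.
rewrite scale0r addr0 scale1r /w subrKC.
have -> : x + lam *: (y - x) = (1 - lam) *: x + lam *: y.
  by rewrite scalerBr scalerBl scale1r addrA addrAC.
apply => [t|t|t].
- by apply: is_derive_line; exact: diff_derivable.
- apply: (is_derive_line (fun z => 'D_w V z)); apply: diff_derivable.
  by have [] := dV2 w.
- rewrite derive2_hessian//; apply: quadratic_form_le.
  by apply: le_trans HM; apply: ereal_sup_ubound; exists (x + t *: w).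
Qed.

End second_order.

(** * Reduction of the minimax risk *)

Section minimax.
Context {R : realType} {d : nat}.
Implicit Types (V f : 'rV[R]_d -> R) (theta : 'rV[R]_d).

Lemma continuous_ndifferentiable V k : ndifferentiable k.+1 V -> continuous V.
Proof. by move=> [dV _] x; exact: differentiable_continuous. Qed.

Lemma L2norm_lt dT (T : measurableType dT) (mu : set T -> \bar R) (g : T -> R)
    (tau : R) : 0 <= tau -> (0 <= \int[mu]_x (`|g x| ^+ 2)%:E)%E ->
  (L2norm mu g < tau%:E)%E -> (\int[mu]_x (g x ^+ 2)%:E <= (tau ^+ 2)%:E)%E.
Proof.
move=> tau0; rewrite /L2norm.
have -> : (fun x => (g x ^+ 2)%:E) = (fun x => (`|g x| ^+ 2)%:E).
  by apply/funext => x; rewrite real_normK ?num_real.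
case: (\int[mu]_x _)%E => [r| |] //=.
  rewrite !lee_fin lte_fin => r0; rewrite powR12_sqrt// => /ltW rt.
  by rewrite -(sqr_sqrtr r0) lerXn2r ?nnegrE ?sqrtr_ge0.
(* An infinite integral is excluded: [+oo] to the power [1 / 2] is [+oo]. *)
by move=> _; rewrite invr_eq0 pnatr_eq0.
Qed.

(** If every [f k] had an estimator with risk below [eta / 17], their squared errors averaged over
    [k] would violate [hypothesis_lower_bound]. Both rates follow from this: [D = d] with a packing
    and all sign patterns, [D = 1] with two points and one function. *)
Lemma minimax_lower_bound (n D : nat) (M eta : R) V (I K : finType)
    (theta : I -> 'rV[R]_d) theta0 (F : set ('rV[R]_d -> R))
    (f : K -> 'rV[R]_d -> R) :
  (\int[lebesgue_rV d]_x (expR (- V x))%:E = 1)%E ->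
  ndifferentiable 2 V ->
  (ereal_sup [set mx_opnorm (hessian V x) | x in [set: 'rV[R]_d]] <= M%:E)%E ->
  0 <= M -> (0 < D)%N -> 2 ^+ D <= #|I|%:R ^+ 2 :> R -> 0 < eta ->
  (forall i, enorm (theta i) <= 1) ->
  (forall i, n%:R * (M * enorm (theta i - theta0) ^+ 2) <= D%:R / 5) ->
  (0 < #|K|)%N -> (forall k, F (f k)) ->
  (forall i j, i != j ->
     4 * eta ^+ 2 * #|K|%:R <= \sum_k (f k (theta i) - f k (theta j)) ^+ 2) ->
  ((eta / 17)%:E <= ereal_sup [set minimax_risk n V f | f in F])%E.
Proof.
move=> V1 dV HM M0 D0 DI eta0 theta1 near0 K0 Ff sep.
rewrite leNgt; apply/negP => sup_lt.
have /choice[T TP] (k : K) : exists T : n.-tuple 'rV[R]_d -> R,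
    estimator T /\ (worst_risk V (f k) T < (eta / 17)%:E)%E.
  have : (minimax_risk n V (f k) < (eta / 17)%:E)%E.
    by apply: le_lt_trans sup_lt; apply: ereal_sup_ubound; exists (f k).
  by move=> /ereal_inf_lt[_ [T eT <-] lt]; exists T.
have cV := continuous_ndifferentiable _ _ dV.
have [nu nuP] := sample_law_density R d V n cV V1.
pose S (th : 'rV[R]_d) (t : n.-tuple 'rV[R]_d) := \sum_(k < n) V (tnth t k - th).
have SE th t : \prod_(k < n) expR (- V (tnth t k - th)) = expR (- S th t).
  by rewrite /S -sumrN expR_sum.
have mS th : measurable_fun [set: n.-tuple 'rV[R]_d] (S th).
  apply: measurable_sum => k; apply: (@measurableT_comp _ _ _ _ _ _ V).
    exact: continuous_measurable_rV.
  apply: (@measurableT_comp _ _ _ _ _ _ (fun x : 'rV[R]_d => x - th) _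
    (fun t : n.-tuple 'rV[R]_d => tnth t k)).
    exact: measurable_translate.
  exact: measurable_tnth.
have S1 th : (\int[nu]_t (expR (- S th t))%:E = 1)%E.
  by have [<- _] := nuP th; apply: eq_integral => t _; rewrite SE.
pose lam : R := (2 * D%:R)^-1.
have D1 : (1 : R) <= D%:R by rewrite ler1n.
have lam0 : 0 < lam by rewrite invr_gt0; lra.
have lam2 : lam <= 2^-1 by rewrite lef_pV2 ?posrE; lra.
have K0' : 0 < #|K|%:R :> R by rewrite ltr0n.
(* A single [f k] may separate only some of the pairs of points; the average over [k] separates them
   all. *)
pose E i t := #|K|%:R^-1 * \sum_k (T k t - f k (theta i)) ^+ 2.
have mT k i : measurable_fun [set: n.-tuple 'rV[R]_d]
    (fun t => (T k t - f k (theta i)) ^+ 2).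
  apply: measurable_funX; apply: measurable_funB => //.
  by have [] := TP k.
have mE i : measurable_fun [set: n.-tuple 'rV[R]_d] (E i).
  by apply: measurable_funM => //; exact: measurable_sum.
have risk i k : (\int[nu]_t ((T k t - f k (theta i)) ^+ 2 * expR (- S (theta i) t))%:E
    <= ((eta / 17) ^+ 2)%:E)%E.
  have [_ law] := nuP (theta i).
  have -> : (\int[nu]_t ((T k t - f k (theta i)) ^+ 2 * expR (- S (theta i) t))%:E
     = \int[sample_law V (theta i)]_t ((T k t - f k (theta i)) ^+ 2)%:E)%E.
    rewrite law.
    - by apply: eq_integral => t _; rewrite SE.
    - exact/measurable_EFinP.
    - by move=> t; rewrite lee_fin sqr_ge0.
  have tau0 : 0 <= eta / 17 by lra.
  apply: (L2norm_lt _ _ _ _ _ tau0).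
    rewrite law.
    - by apply: integral_ge0 => t _; rewrite -EFinM lee_fin SE mulr_ge0 ?sqr_ge0 ?expR_ge0.
    - apply/measurable_EFinP; under eq_fun do rewrite real_normK ?num_real//.
      exact: mT.
    - by move=> t; rewrite lee_fin sqr_ge0.
  apply: (le_lt_trans _ (proj2 (TP k))).
  by apply: ereal_sup_ubound; exists (theta i); first exact: theta1.
have := @hypothesis_lower_bound R I _ _ nu D lam (eta ^+ 2) ((eta / 17) ^+ 2)
  (S theta0) (fun i => S (theta i))
  (fun i => S ((1 - lam) *: theta i + lam *: theta0)) E D0 erefl.
move=> /(_ _ DI); rewrite exprn_gt0// => /(_ isT) bound.
(* The contradiction is [256 < 289 = 17 ^ 2]. *)
suff : eta ^+ 2 <= 256 * (eta / 17) ^+ 2.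
  have : 0 < eta ^+ 2 by rewrite exprn_gt0.
  have -> : 256 * (eta / 17) ^+ 2 = 256 / 289 * eta ^+ 2 by field.
  lra.
apply: bound => //.
- move=> i t; rewrite /S !mulr_sumr -big_split/=.
  apply: (@le_trans _ _ (\sum_(k < n) (V (tnth t k - ((1 - lam) *: theta i + lam *: theta0))
     + lam * (M * enorm (theta i - theta0) ^+ 2) / 2))).
    apply: ler_sum => k _.
    have l01 : 0 <= lam <= 1 by apply/andP; split; lra.
    have := hessian_semiconcave V M lam (tnth t k - theta i) (tnth t k - theta0) l01 dV HM.
    have -> : (1 - lam) *: (tnth t k - theta i) + lam *: (tnth t k - theta0) =
       tnth t k - ((1 - lam) *: theta i + lam *: theta0).
      by apply/rowP => j; rewrite !mxE; ring.
    have -> : tnth t k - theta0 - (tnth t k - theta i) = theta i - theta0.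
      by apply/rowP => j; rewrite !mxE; ring.
    move/le_trans; apply; rewrite lerD2l ler_pM2r ?invr_gt0//.
    have Me0 : 0 <= M * enorm (theta i - theta0) ^+ 2 by rewrite mulr_ge0 ?sqr_ge0.
    rewrite -mulrA; apply: ler_wpM2l; first exact: ltW.
    by apply: ler_piMl => //; lra.
  rewrite big_split/= lerD2l sumr_const card_ord -[_ *+ n]mulr_natl.
  have -> : n%:R * (lam * (M * enorm (theta i - theta0) ^+ 2) / 2) =
      lam / 2 * (n%:R * (M * enorm (theta i - theta0) ^+ 2)) by ring.
  (* [near0] is calibrated for this: with [lam = 1 / (2 D)], the total curvature loss over the
     sample is at most [1 / 20]. *)
  have -> : 20^-1 = lam / 2 * (D%:R / 5) :> R.
    by rewrite /lam; field; rewrite gt_eqF//; lra.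
  by rewrite ler_wpM2l// divr_ge0// ltW.
- by move=> i t; rewrite mulr_ge0 ?invr_ge0 ?sumr_ge0// => k _; rewrite sqr_ge0.
- move=> i j t ij; rewrite -mulrDr mulrC ler_pdivlMl//.
  rewrite -(ler_pM2l (_ : 0 < 2 :> R))//; apply: le_trans (_ : 4 * eta ^+ 2 * #|K|%:R <= _).
    by rewrite le_eqVlt; apply/orP; left; apply/eqP; ring.
  apply: (le_trans (sep i j ij)); rewrite -big_split/= mulr_sumr.
  apply: ler_sum => k _; set u := f k (theta i); set v := f k (theta j).
  (* This square yields [(u - v) ^ 2 <= 2 (T - u) ^ 2 + 2 (T - v) ^ 2]. *)
  have : 0 <= (2 * T k t - u - v) ^+ 2 by rewrite sqr_ge0.
  by rewrite !expr2; lra.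
- move=> i; rewrite /E.
  have -> : (fun t => (#|K|%:R^-1 * (\sum_k (T k t - f k (theta i)) ^+ 2) *
       expR (- S (theta i) t))%:E) = (fun t => (#|K|%:R^-1 *
       \sum_k ((T k t - f k (theta i)) ^+ 2 * expR (- S (theta i) t)))%:E).
    by apply/funext => t; rewrite -mulrA mulr_suml.
  have mTS k : measurable_fun [set: n.-tuple 'rV[R]_d]
      (fun t => (T k t - f k (theta i)) ^+ 2 * expR (- S (theta i) t)).
    by apply: measurable_funM => //; do 2 apply: measurableT_comp => //.
  have TS0 k t : 0 <= (T k t - f k (theta i)) ^+ 2 * expR (- S (theta i) t).
    by rewrite mulr_ge0 ?sqr_ge0 ?expR_ge0.
  rewrite integralZl_EFin_ge0; last 3 first.
  - by rewrite invr_ge0 ltW.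
  - exact: measurable_sum.
  - by move=> t; apply: sumr_ge0.
  rewrite (integral_sum_EFin K _ _ nu (fun k t =>
    (T k t - f k (theta i)) ^+ 2 * expR (- S (theta i) t)))//.
  apply: (@le_trans _ _ (#|K|%:R^-1%:E * \sum_(k : K) ((eta / 17) ^+ 2)%:E)%E).
    apply: lee_wpmul2l; first by rewrite lee_fin invr_ge0 ltW.
    by apply: lee_sum => k _; exact: risk.
  rewrite sumEFin -EFinM lee_fin sumr_const -[X in _^-1 * X <= _]mulr_natl.
  by rewrite mulKf// gt_eqF.
Qed.

End minimax.

(** * Bump functions *)

Section positive_part.
Context {R : realType}.
Implicit Types s h : R.

Local Notation pos s := (Num.max 0 s).

Lemma pos_ge0 s : 0 <= pos s.
Proof. by rewrite le_max lexx. Qed.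

Lemma mulr_pos s n : s * pos s ^+ n.+1 = pos s ^+ n.+2.
Proof.
rewrite [RHS]exprS; have [s0|s0] := leP s 0; last by [].
by rewrite !exprS !mul0r mulr0.
Qed.

(** The remainder bound also holds across the kink at 0, so the derivative of the squared positive
    part is found without distinguishing the sign of [s]. *)
Lemma pos_sqr_taylor s h :
  `|pos (h + s) ^+ 2 - pos s ^+ 2 - 2 * h * pos s| <= h ^+ 2.
Proof.
rewrite ler_norml !expr2.
have [] := leP s 0 => ?; have [] := leP (h + s) 0 => ?; apply/andP; split; nra.
Qed.

Lemma is_derive_pos_sqr s :
  is_derive s 1 (fun s : R => pos s ^+ 2) (2 * pos s).
Proof.
have cv : h^-1 *: (((fun s : R => pos s ^+ 2) \o shift s) (h *: (1:R)) - pos s ^+ 2)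
    @[h --> 0^'] --> 2 * pos s.
  apply/cvgrPdist_le => e e0; near=> h => /=.
  have h0 : h != 0 by near: h; exact: nbhs_dnbhs_neq.
  have he : `|h| <= e.
    near: h; apply: dnbhs0_le; exact: e0.
  rewrite [h *: _]mulr1 /GRing.scale/=.
  have -> : 2 * pos s - h^-1 * (pos (h + s) ^+ 2 - pos s ^+ 2) =
      - (h^-1 * (pos (h + s) ^+ 2 - pos s ^+ 2 - 2 * h * pos s)).
    by field.
  rewrite normrN normrM normfV ler_pdivrMl ?normr_gt0//.
  apply: (le_trans (pos_sqr_taylor _ _)).
  by rewrite -real_normK ?num_real// expr2 ler_wpM2l.
split; first by apply/cvg_ex; exists (2 * pos s).
exact: cvg_lim cv.
Unshelve. all: by end_near. Qed.

(** Induction by the product rule, writing [pos s ^ (n + 3)] as [s * pos s ^ (n + 2)]. *)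
Lemma is_derive_pos_exp n s :
  is_derive s 1 (fun s : R => pos s ^+ n.+2) (n.+2%:R * pos s ^+ n.+1).
Proof.
elim: n s => [|n IH] s; first by rewrite expr1; exact: is_derive_pos_sqr.
have -> : (fun s : R => pos s ^+ n.+3) = id * (fun s : R => pos s ^+ n.+2).
  by apply/funext => z; rewrite fctE -mulr_pos.
apply: is_derive_eq.
rewrite /GRing.scale/= mulr1 mulrCA mulr_pos -[n.+3%:R]natr1; ring.
Qed.

End positive_part.

Section bump_class.
Context {R : realType} {d : nat}.
Implicit Types (x v w theta : 'rV[R]_d) (g : 'rV[R]_d -> R).

Definition dot v w : R := \sum_i v ord0 i * w ord0 i.

Lemma differentiable_dot theta w x : differentiable (fun y => dot (y - theta) w) x.
Proof.
have -> : (fun y => dot (y - theta) w) =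
    \sum_i (w ord0 i *: ((fun y : 'rV[R]_d => y ord0 i) + cst (- theta ord0 i))).
  apply/funext => y; rewrite fct_sumE /dot; apply: eq_bigr => i _.
  by rewrite !mxE /= mulrC.
apply: differentiable_sum => i; apply: differentiableZ; apply: differentiableD.
  exact: differentiable_coord.
exact: differentiable_cst.
Qed.

Lemma derive_dot theta w v x : 'D_v (fun y => dot (y - theta) w) x = dot v w.
Proof.
suff cv : h^-1 *: (((fun y => dot (y - theta) w) \o shift x) (h *: v)
    - dot (x - theta) w) @[h --> 0^'] --> dot v w by exact: cvg_lim cv.
apply: cvg_near_cst; near=> h.
have h0 : h != 0 by near: h; exact: nbhs_dnbhs_neq.
rewrite /dot /= -sumrB; apply: (mulfI h0); rewrite mulVKf// mulr_sumr.
by apply: eq_bigr => i _; rewrite !mxE; ring.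
Unshelve. all: by end_near. Qed.

Definition ball_gap (eps : R) theta x : R := eps ^+ 2 - enorm (x - theta) ^+ 2.

Lemma ball_gapE eps theta : ball_gap eps theta =
  cst (eps ^+ 2) - \sum_i ((fun y => dot (y - theta) (delta_mx ord0 i)) ^+ 2).
Proof.
apply/funext => x; rewrite !fctE fct_sumE /ball_gap enorm_sqr; congr (_ - _).
apply: eq_bigr => i _; rewrite fctE /dot (bigD1 i)//= big1 ?addr0.
  by rewrite [delta_mx _ _ _ _]mxE !eqxx mulr1.
by move=> j ji; rewrite [delta_mx _ _ _ _]mxE (negbTE ji) andbF mulr0.
Qed.

Lemma differentiable_ball_gap eps theta x : differentiable (ball_gap eps theta) x.
Proof.
rewrite ball_gapE; apply: differentiableB; first exact: differentiable_cst.
by apply: differentiable_sum => i; apply: differentiableX; exact: differentiable_dot.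
Qed.

Lemma derive_ball_gap eps theta v x :
  'D_v (ball_gap eps theta) x = - 2 * dot (x - theta) v.
Proof.
rewrite ball_gapE deriveB; last 2 first.
- exact: diff_derivable.
- apply: diff_derivable; apply: differentiable_sum => i.
  by apply: differentiableX; exact: differentiable_dot.
rewrite derive_cst sub0r derive_sum; last first.
  by move=> i; apply: diff_derivable; apply: differentiableX; exact: differentiable_dot.
rewrite mulNr; congr (- _); rewrite [X in _ = 2 * X]/dot mulr_sumr; apply: eq_bigr => i _.
rewrite deriveX; last by apply: diff_derivable; exact: differentiable_dot.
have E z : dot z (delta_mx ord0 i) = z ord0 i.
  rewrite /dot (bigD1 i)//= big1 ?addr0.
    by rewrite mxE !eqxx mulr1.
  by move=> j ji; rewrite mxE (negbTE ji) andbF mulr0.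
by rewrite derive_dot !E /GRing.scale/= expr1; ring.
Qed.

(** A piecewise polynomial bump, smoother as [a] grows: its derivatives are explicit sums of
    products of lower bumps and linear forms. *)
Definition ball_bump (eps : R) theta (a : nat) x : R :=
  Num.max 0 (ball_gap eps theta x) ^+ a.

Lemma bump_deriv eps theta a v x :
  differentiable (ball_bump eps theta a.+2) x /\
  'D_v (ball_bump eps theta a.+2) x =
    - 2 * a.+2%:R * (ball_bump eps theta a.+1 x * dot (x - theta) v).
Proof.
pose psi (s : R) : R := Num.max 0 s ^+ a.+2.
have dpsi (s : R) : is_derive s 1 psi (a.+2%:R * Num.max 0 s ^+ a.+1).
  exact: is_derive_pos_exp.
have psid (s : R) : differentiable psi s.
  by apply/derivable1_diffP; have [] := dpsi s.
have gd := differentiable_ball_gap eps theta x.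
have -> : ball_bump eps theta a.+2 = psi \o ball_gap eps theta by [].
have cd : differentiable (psi \o ball_gap eps theta) x by exact: differentiable_comp.
split=> //; rewrite deriveE// diff_comp//=.
have <- : 'D_v (ball_gap eps theta) x = 'd (ball_gap eps theta) x v by exact: deriveE.
rewrite derive_ball_gap diff1E// derive1E; have [_ ->] := dpsi (ball_gap eps theta x).
rewrite /ball_bump /GRing.scale/=; ring.
Qed.

Variables (eps : R) (theta : 'rV[R]_d).

(* [A] bounds the coefficients of a sum of products of at least [a] factors
   [max 0 (eps ^ 2 - |x - theta| ^ 2)], counted with weight 2, and linear forms
   vanishing at [theta], of total weight [e]; so [g = O(A * eps ^ e)]. *)
Inductive bump_class (a : nat) : nat -> R -> ('rV[R]_d -> R) -> Prop :=
| bump_class_bump b : (a <= b)%N ->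
    bump_class a (2 * b)%N 1 (ball_bump eps theta b)
| bump_class_dot e A g w : bump_class a e A g ->
    bump_class a e.+1 (A * enorm w) (fun x => g x * dot (x - theta) w)
| bump_class_add e A B g h : bump_class a e A g -> bump_class a e B h ->
    bump_class a e (A + B) (g + h)
| bump_class_scale e A g c : bump_class a e A g ->
    bump_class a e (`|c| * A) (c *: g)
| bump_class_le e A B g : A <= B -> bump_class a e A g -> bump_class a e B g.

Lemma bump_class_ge0 a e A g : bump_class a e A g -> 0 <= A.
Proof.
elim=> {e A g} //.
- by move=> e A g w _ A0; rewrite mulr_ge0// enorm_ge0.
- by move=> e A B g h _ A0 _ B0; rewrite addr_ge0.
- by move=> e A g c _ A0; rewrite mulr_ge0.
- by move=> e A B g AB _ /le_trans; apply.
Qed.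

Lemma bump_class_deg a e A g : bump_class a e A g -> (2 * a <= e)%N.
Proof.
elim=> {e A g} //.
- by move=> b ab; rewrite leq_mul2l.
- by move=> e A g w _ /leqW.
Qed.

Lemma bump_class_W a e A g : bump_class a.+1 e A g -> bump_class a e A g.
Proof.
elim=> {e A g}.
- by move=> b /ltnW; exact: bump_class_bump.
- by move=> e A g w _; exact: bump_class_dot.
- by move=> e A B g h _ + _; exact: bump_class_add.
- by move=> e A g c _; exact: bump_class_scale.
- by move=> e A B g AB _; exact: bump_class_le.
Qed.

(** Up to sign, a bump of weight [2 b] differentiates to [2 b] times a bump of weight [2 (b - 1)]
    and a linear form. The product rule adds these factors up to the total weight [e], as for a
    homogeneous polynomial of degree [e]. *)
Lemma bump_class_derive a e A g : bump_class a.+2 e A g ->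
  (forall x, differentiable g x) /\
  forall v, bump_class a.+1 e.-1 (e%:R * A * enorm v) (fun x => 'D_v g x).
Proof.
elim=> {e A g}.
- move=> [//|[//|b]] ab; split=> [x|v].
    by have [] := bump_deriv eps theta b 0 x.
  have -> : (fun x => 'D_v (ball_bump eps theta b.+2) x) =
      (- 2 * b.+2%:R) *: (fun x => ball_bump eps theta b.+1 x * dot (x - theta) v).
    by apply/funext => x; have [_ ->] := bump_deriv eps theta b v x.
  have -> : (2 * b.+2).-1 = (2 * b.+1).+1 by lia.
  apply: (bump_class_le _ _ (`|- 2 * b.+2%:R| * (1 * enorm v))).
    rewrite normrM normrN !ger0_norm// natrM; lra.
  by apply/bump_class_scale/bump_class_dot/bump_class_bump.
- move=> e A g w Bg [dg IH]; split=> [x|v].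
    by apply: (@differentiableM _ _ g) => //; exact: differentiable_dot.
  (* The weight is at least [2 * (a + 2)], so [e.-1] is a true predecessor. *)
  have e0 : (0 < e)%N by have := bump_class_deg _ _ _ _ Bg; lia.
  have -> : (fun x => 'D_v (fun x => g x * dot (x - theta) w) x) =
      dot v w *: g + (fun x => 'D_v g x * dot (x - theta) w).
    apply/funext => x.
    rewrite (@deriveM _ _ g); last 2 first.
    - exact: diff_derivable.
    - by apply: diff_derivable; exact: differentiable_dot.
    by rewrite derive_dot !fctE /GRing.scale/= mulrC [X in _ + X]mulrC.
  rewrite /=; apply: (bump_class_le _ _
      (`|dot v w| * A + e%:R * A * enorm v * enorm w)).
    rewrite -natr1 !mulrDl mul1r addrC lerD//.
      by rewrite le_eqVlt; apply/orP; left; apply/eqP; ring.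
    have := ler_wpM2r (bump_class_ge0 _ _ _ _ Bg) (dot_le_enorm v w).
    by move/le_trans; apply; rewrite le_eqVlt; apply/orP; left; apply/eqP; ring.
  apply: bump_class_add; first exact/bump_class_scale/bump_class_W.
  by rewrite -{1}(prednK e0); apply: bump_class_dot; exact: IH.
- move=> e A B g h _ [dg IHg] _ [dh IHh]; split=> [x|v].
    exact: differentiableD.
  have -> : (fun x => 'D_v (g + h) x) = (fun x => 'D_v g x) + (fun x => 'D_v h x).
    by apply/funext => x; rewrite deriveD//; exact: diff_derivable.
  by rewrite mulrDr mulrDl; exact: bump_class_add.
- move=> e A g c _ [dg IHg]; split=> [x|v].
    exact: differentiableZ.
  have -> : (fun x => 'D_v (c *: g) x) = c *: (fun x => 'D_v g x).
    by apply/funext => x; rewrite deriveZ//; exact: diff_derivable.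
  by rewrite mulrCA -mulrA; exact: bump_class_scale.
- move=> e A B g AB _ [dg IHg]; split=> // v.
  apply: bump_class_le (IHg v).
  by rewrite ler_wpM2r ?enorm_ge0// ler_wpM2l.
Qed.

Hypothesis eps0 : 0 < eps.

(** The index [a.+1] guarantees a bump factor in every product, hence the vanishing outside the
    ball; with exponent 0, [ball_bump] is the constant 1. *)
Lemma bump_class_bound a e A g x : bump_class a.+1 e A g ->
  `|g x| <= A * eps ^+ e * (enorm (x - theta) < eps)%R%:R.
Proof.
have [xe|xe] := ltP (enorm (x - theta)) eps; rewrite ?mulr1 ?mulr0.
  elim=> {e A g}.
  - move=> b _; rewrite mul1r normrX exprM ger0_norm ?pos_ge0//.
    apply: lerXn2r; rewrite ?nnegrE ?pos_ge0 ?sqr_ge0//.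
    by rewrite ge_max sqr_ge0 /ball_gap gerBl sqr_ge0.
  - move=> e A g w Bg IH; rewrite normrM exprS.
    have -> : A * enorm w * (eps * eps ^+ e) = A * eps ^+ e * (eps * enorm w) by ring.
    apply: ler_pM => //; apply: (le_trans (dot_le_enorm _ _)).
    by rewrite ler_wpM2r ?enorm_ge0// ltW.
  - move=> e A B g h _ IHg _ IHh; rewrite mulrDl.
    by apply: (le_trans (ler_normD _ _)); exact: lerD.
  - by move=> e A g c _ IH; rewrite normrM -mulrA ler_wpM2l.
  - move=> e A B g AB _ /le_trans; apply.
    by rewrite ler_wpM2r// exprn_ge0// ltW.
suff gx0 : bump_class a.+1 e A g -> g x = 0 by move=> /gx0 ->; rewrite normr0.
elim=> {e A g}.
- move=> [//|b] _; rewrite /ball_bump; have -> : Num.max 0 (ball_gap eps theta x) = 0.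
    apply/max_idPl; rewrite /ball_gap subr_le0.
    by rewrite lerXn2r ?nnegrE ?enorm_ge0// ltW.
  by rewrite expr0n.
- by move=> e A g w _ ->; rewrite mul0r.
- by move=> e A B g h _ g0 _ h0; rewrite fctE g0 h0 addr0.
- by move=> e A g c _ g0; rewrite fctE g0 scaler0.
- by [].
Qed.

End bump_class.

Section iterated_derivatives.
Context {R : realType} {d : nat}.
Implicit Types (x y v w theta : 'rV[R]_d) (g : 'rV[R]_d -> R).
Implicit Type vs : seq 'rV[R]_d.

(** Convertible with [nderiv], but over a plain sequence, so that induction on the list of
    directions is available. *)
Definition iter_derive vs g : 'rV[R]_d -> R :=
  foldr (fun w (h : 'rV[R]_d -> R) => (fun y => 'D_w h y)) g vs.

Lemma bump_class_iter_derive eps theta a e A g vs :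
  bump_class eps theta (a.+1 + size vs) e A g ->
  bump_class eps theta a.+1 (e - size vs)
    (e%:R ^+ size vs * A * \prod_(w <- vs) enorm w) (iter_derive vs g).
Proof.
elim: vs a => [|w vs IH] a /=.
  by rewrite addn0 subn0 big_nil expr0 mul1r mulr1.
rewrite -addSnnS => /IH{}IH; have [_ /(_ w)] := bump_class_derive _ _ _ _ _ _ IH.
rewrite -subnS; apply: bump_class_le.
rewrite big_cons exprS.
have P0 : 0 <= e%:R ^+ size vs * A * \prod_(w <- vs) enorm w.
  exact: bump_class_ge0 IH.
set P := e%:R ^+ _ * _ * _ in P0 *.
have -> : e%:R * e%:R ^+ size vs * A * (enorm w * \prod_(j <- vs) enorm j) =
    e%:R * P * enorm w by rewrite /P; ring.
(* The factor of this differentiation is the current weight [e - size vs], bounded by [e]. *)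
by rewrite !ler_wpM2r ?enorm_ge0// ler_nat leq_subr.
Qed.

Lemma ndifferentiable_bump_class eps theta a k e A g :
  bump_class eps theta (a.+1 + k) e A g -> ndifferentiable k g.
Proof.
elim: k e A g => [//|k IH] e A g; rewrite addnS addSn => /bump_class_derive[dg Dg].
by split=> // v; exact: IH (Dg v).
Qed.

Lemma ndifferentiable_sum k N (h : 'I_N -> 'rV[R]_d -> R) :
  (forall i, ndifferentiable k (h i)) -> ndifferentiable k (\sum_i h i).
Proof.
elim: k h => [//|k IH] h dh; split=> [x|v].
  by apply: differentiable_sum => i; have [] := dh i.
have -> : (fun x => 'D_v (\sum_i h i) x) = \sum_i (fun x => 'D_v (h i) x).
  apply/funext => x; rewrite derive_sum ?fct_sumE// => i.
  by apply: diff_derivable; have [] := dh i.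
by apply: IH => i; have [_] := dh i; exact.
Qed.

Lemma iter_derive_sum_bump_class N (h : 'I_N -> 'rV[R]_d -> R) vs eps
    (theta : 'I_N -> 'rV[R]_d) a e A :
  (forall i, bump_class eps (theta i) (a.+1 + size vs) e A (h i)) ->
  iter_derive vs (\sum_i h i) = \sum_i iter_derive vs (h i).
Proof.
elim: vs a => [//|w vs IH] a /= Bh.
rewrite (IH a.+1); last by move=> i; rewrite addSnnS.
apply/funext => x; rewrite derive_sum ?fct_sumE// => i; apply: diff_derivable.
have := bump_class_iter_derive eps (theta i) a.+1 e A (h i) vs.
by rewrite addSnnS => /(_ (Bh i)) /bump_class_derive[].
Qed.

Lemma lipschitz_of_derive g (B : R) :
  (forall x, differentiable g x) -> (forall x w, `|'D_w g x| <= B * enorm w) ->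
  forall x y, `|g x - g y| <= B * enorm (x - y).
Proof.
move=> dg DB x y; pose w := x - y.
have dl (t : R) : is_derive t 1 (fun t : R => g (y + t *: w)) ('D_w g (y + t *: w)).
  by apply: is_derive_line; exact: diff_derivable.
have [|c _] := @MVT_segment R _ _ 0 1 ler01 (fun t _ => dl t).
  apply: continuous_subspaceT => t.
  by apply: differentiable_continuous; apply/derivable1_diffP; have [] := dl t.
by rewrite scale1r scale0r addr0 subr0 mulr1 subrKC => ->.
Qed.

End iterated_derivatives.

(** * Sums of disjoint bumps in the Hölder ball *)

Section multibump.
Context {R : realType} {d : nat} (N l : nat).
Variables (rho eps : R) (theta : 'I_N -> 'rV[R]_d) (c : 'I_N -> R).
Hypotheses (rho0 : 0 < rho) (rho1 : rho <= 1) (eps0 : 0 < eps) (eps1 : eps <= 1).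
Hypothesis sep : forall i j, i != j -> 2 * eps <= enorm (theta i - theta j).

Local Notation m := (2 * l.+2)%N.

(* [sup |D ^ (l + 1) (ball_bump eps theta (l + 2))| <= m ^ (l + 1) eps ^ (m - l - 1)]. *)
Definition bump_scale : R :=
  eps `^ (l%:R + rho) / eps ^+ m / (4 * m%:R ^+ l.+1).

Definition multibump : 'rV[R]_d -> R := \sum_i (c i *: ball_bump eps (theta i) l.+2).

Hypothesis cle : forall i, `|c i| <= bump_scale.

Let act i x : R := (enorm (x - theta i) < eps)%R%:R.

Let eps_ge0 : 0 <= eps. Proof. exact: ltW. Qed.

Let act_ge0 i x : 0 <= act i x. Proof. by rewrite ler0n. Qed.

(** Centres at distance at least [2 * eps] have disjoint balls, so at each point at most one bump is
    active. *)
Let sum_act x : \sum_i act i x <= 1.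
Proof.
have [/existsP[i0 Ei0]|/existsPn none] := boolP [exists i, enorm (x - theta i) < eps].
  rewrite (bigD1 i0)//= /act Ei0 big1 ?addr0// => i ii0.
  case: ltP => // Ei; have := sep _ _ ii0.
  have -> : theta i - theta i0 = (x - theta i0) - (x - theta i).
    by apply/rowP => j; rewrite !mxE; ring.
  have := enormD (x - theta i0) (- (x - theta i)); rewrite enormN; lra.
by rewrite big1// => i _; rewrite /act (negbTE (none i)).
Qed.

(** The number [k] of recorded factors stays free: after the derivatives along [vs], the sup bound
    keeps one factor and the Lipschitz bound keeps two. *)
Let class i k : (k <= l.+2)%N ->
  bump_class eps (theta i) k m bump_scale (c i *: ball_bump eps (theta i) l.+2).
Proof.
move=> kl; apply: (bump_class_le _ _ _ _ _ _ _ (cle i)).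
by rewrite -[`|c i|]mulr1; apply/bump_class_scale/bump_class_bump.
Qed.

Let scale0 : 0 <= bump_scale.
Proof.
apply: divr_ge0; first by apply: divr_ge0; rewrite ?powR_ge0 ?exprn_ge0.
by apply: mulr_ge0 => //; exact: exprn_ge0.
Qed.

Let m_ge1 : 1 <= m%:R :> R.
Proof. by rewrite ler1n. Qed.

Let epsl : eps `^ (l%:R + rho) = eps ^+ l * eps `^ rho.
Proof.
by rewrite powRD ?powR_mulrn// (gt_eqF eps0) implybT.
Qed.

Let scaleE j : (j <= l)%N ->
  m%:R ^+ l.+1 * bump_scale * eps ^+ (m - j) = eps ^+ (l - j) * eps `^ rho / 4.
Proof.
move=> jl; rewrite /bump_scale epsl.
have -> : eps ^+ m = eps ^+ (m - j) * eps ^+ j by rewrite -exprD subnK//; lia.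
have -> : eps ^+ l = eps ^+ (l - j) * eps ^+ j by rewrite -exprD subnK.
field; rewrite !expf_neq0 ?gt_eqF//; lra.
Qed.

Let prod_enorm_le1 (vs : seq 'rV[R]_d) : (forall v, v \in vs -> enorm v <= 1) ->
  0 <= \prod_(v <- vs) enorm v <= 1.
Proof.
move=> vs1; rewrite big_seq; apply/andP; split.
  by apply: prodr_ge0 => v _; exact: enorm_ge0.
apply: prodr_ile1 => v /vs1 v1; rewrite v1 andbT; exact: enorm_ge0.
Qed.

Let bound_j i x (vs : seq 'rV[R]_d) : (size vs <= l)%N ->
  (forall v, v \in vs -> enorm v <= 1) ->
  `|iter_derive vs (c i *: ball_bump eps (theta i) l.+2) x| <=
  eps ^+ (l - size vs) * eps `^ rho / 4 * act i x.
Proof.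
move=> sl vs1.
have /bump_class_iter_derive Bi : bump_class eps (theta i) (0.+1 + size vs) m
  bump_scale (c i *: ball_bump eps (theta i) l.+2) by apply: class; lia.
apply: (le_trans (bump_class_bound _ _ eps0 _ _ _ _ x Bi)).
rewrite ler_wpM2r// -scaleE// ler_wpM2r ?exprn_ge0//.
have /andP[p0 p1] := prod_enorm_le1 vs vs1.
apply: (@le_trans _ _ (m%:R ^+ size vs * bump_scale)).
  by rewrite ler_piMr// mulr_ge0// exprn_ge0.
by rewrite ler_wpM2r// ler_weXn2l//; lia.
Qed.

(** One derivative beyond order [l] costs a further factor [m] and one power of [eps]; this is why
    [bump_scale] divides by [m ^ (l + 1)]. *)
Let bound_lip i x y (vs : seq 'rV[R]_d) : size vs = l ->
  (forall v, v \in vs -> enorm v <= 1) ->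
  `|iter_derive vs (c i *: ball_bump eps (theta i) l.+2) x -
    iter_derive vs (c i *: ball_bump eps (theta i) l.+2) y| <=
  eps `^ rho / 4 / eps * enorm (x - y).
Proof.
move=> sl vs1.
have /bump_class_iter_derive Bi : bump_class eps (theta i) (1.+1 + size vs) m
  bump_scale (c i *: ball_bump eps (theta i) l.+2) by apply: class; lia.
have [dG DG] := bump_class_derive _ _ _ _ _ _ Bi.
apply: lipschitz_of_derive => // z w.
apply: (le_trans (bump_class_bound _ _ eps0 _ _ _ _ z (DG w))).
have /andP[p0 p1] := prod_enorm_le1 vs vs1.
have := scaleE l (leqnn _); rewrite subnn expr0 mul1r => <-; rewrite sl.
have -> : eps ^+ (m - l) = eps ^+ (m - l).-1 * eps.
  by rewrite -exprSr; congr (_ ^+ _); lia.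
rewrite [leRHS](_ : _ = m%:R ^+ l.+1 * bump_scale * enorm w * eps ^+ (m - l).-1);
  last by field; rewrite gt_eqF.
set P := \prod_(v <- _) _ in p0 p1 *.
apply: (@le_trans _ _ ((m - l)%:R * (m%:R ^+ l * bump_scale * P) * enorm w *
    eps ^+ (m - l).-1)).
  rewrite ler_piMr ?lern1 ?leq_b1//.
  by repeat (apply: mulr_ge0 => //); rewrite ?exprn_ge0 ?enorm_ge0.
have L1 : (m - l)%:R <= m%:R :> R by rewrite ler_nat leq_subr.
have Z0 : 0 <= m%:R ^+ l * bump_scale by apply: mulr_ge0 => //; exact: exprn_ge0.
have L2 : m%:R ^+ l * bump_scale * P <= m%:R ^+ l * bump_scale by rewrite ler_piMr.
apply: ler_wpM2r; first exact: exprn_ge0.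
apply: ler_wpM2r; first exact: enorm_ge0.
rewrite [m%:R ^+ l.+1]exprS -[leRHS]mulrA.
by apply: ler_pM => //; exact: mulr_ge0.
Qed.

(** This interpolates between the sup bound and the Lipschitz bound: for [0 < r < eps],
    [r / eps <= (r / eps) ^ rho] because [rho <= 1]. *)
Let pow_min (r : R) : 0 <= r -> eps `^ rho * Num.min 1 (r / eps) <= r `^ rho.
Proof.
move=> r0; have [re|re] := leP eps r.
  apply: (@le_trans _ _ (eps `^ rho)).
    by rewrite ler_piMr ?powR_ge0// ge_min lexx.
  by apply: ge0_ler_powR; rewrite ?nnegrE//; exact: ltW.
have [->|r_neq0] := eqVneq r 0.
  by rewrite mul0r; have -> : Num.min 1 0 = 0 :> R; [apply/min_idPr|rewrite mulr0 powR_ge0].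
have rpos : 0 < r by rewrite lt_def r_neq0.
apply: (@le_trans _ _ (eps `^ rho * (r / eps))).
  by rewrite ler_wpM2l ?powR_ge0// ge_min lexx orbT.
have q01 : 0 < r / eps <= 1 by rewrite divr_gt0//= ler_pdivrMr// mul1r ltW.
apply: (le_trans (ler_wpM2l (powR_ge0 _ _) (ger1_powR q01 rho1))).
rewrite -powRM ?divr_ge0//.
by rewrite mulrC divfK// gt_eqF.
Qed.

(** At most one bump is active at [x] and one at [y], so the number of bumps does not enter.
    Derivatives of order [l] at two points are compared through their size [eps ^ rho / 4] if the
    distance is at least [eps], and through their Lipschitz constant otherwise. *)
Lemma multibump_holder_ball : holder_ball l rho multibump.
Proof.
have iterE (vs : seq 'rV[R]_d) : (size vs <= l)%N ->
    iter_derive vs multibump =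
    \sum_i iter_derive vs (c i *: ball_bump eps (theta i) l.+2).
  move=> sl.
  apply: (@iter_derive_sum_bump_class _ _ _ _ _ eps theta 0 m bump_scale) => i.
  by apply: class; lia.
split.
  apply: ndifferentiable_sum => i; apply: (@ndifferentiable_bump_class _ _ eps (theta i) 0).
  by apply: class; lia.
have vs_le1 j (v : j.-tuple 'rV[R]_d) : (forall i, enorm (tnth v i) <= 1) ->
    forall w, w \in val v -> enorm w <= 1.
  by move=> v1 w /tnthP[i ->].
rewrite /holder_norm ge_max; apply/andP; split.
  apply: bigmax_le => // j _; apply: ge_ereal_sup => _ [x _ <-].
  apply: ge_ereal_sup => _ [v v1 <-]; rewrite lee_fin.
  have jl : (size v <= l)%N by rewrite size_tuple -ltnS.
  rewrite -[nderiv _ _ _]/(iter_derive v multibump x) iterE// fct_sumE.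
  apply: (le_trans (ler_norm_sum _ _ _)).
  have H1 : eps ^+ (l - size v) * eps `^ rho / 4 <= 1.
    have e1 : eps ^+ (l - size v) <= 1 by exact: exprn_ile1.
    have e2 : eps `^ rho <= 1.
      have <- : 1 `^ rho = 1 :> R by rewrite powR1.
      by apply: ge0_ler_powR; rewrite ?nnegrE//; exact: ltW.
    have e3 : 0 <= eps `^ rho by exact: powR_ge0.
    have e4 : 0 <= eps ^+ (l - size v) by exact: exprn_ge0.
    nra.
  apply: (@le_trans _ _ (\sum_i act i x)); last exact: sum_act.
  apply: ler_sum => i _; apply: (le_trans (bound_j i x v jl (vs_le1 _ v v1))).
  by rewrite ler_piMl.
apply: ge_ereal_sup => _ [[x y] /= xy <-].
set r := enorm (x - y).
have r0 : 0 < r by apply: enorm_gt0; rewrite subr_eq0.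
have rr0 : 0 < r `^ rho by exact: powR_gt0.
rewrite -[leRHS](_ : (r `^ rho)%:E * ((r `^ rho)^-1)%:E = 1%E)%E; last first.
  by rewrite -EFinM mulfV// gt_eqF.
apply: lee_wpmul2r; first by rewrite lee_fin invr_ge0; exact: ltW.
apply: ge_ereal_sup => _ [v v1 <-]; rewrite lee_fin.
have sv : size v = l by exact: size_tuple.
have svl : (size v <= l)%N by rewrite sv.
rewrite -[nderiv _ x _]/(iter_derive v multibump x).
rewrite -[nderiv _ y _]/(iter_derive v multibump y) iterE// !fct_sumE -sumrB.
apply: (le_trans (ler_norm_sum _ _ _)).
apply: (@le_trans _ _ (\sum_i r `^ rho / 4 * (act i x + act i y))); last first.
  rewrite -mulr_sumr big_split/=.
  have := sum_act x; have := sum_act y.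
  have : 0 <= \sum_i act i x by exact: sumr_ge0.
  have : 0 <= \sum_i act i y by exact: sumr_ge0.
  nra.
apply: ler_sum => i _; set G := iter_derive v _.
have bx := bound_j i x v svl (vs_le1 _ v v1).
have by_ := bound_j i y v svl (vs_le1 _ v v1).
have bl := bound_lip i x y v sv (vs_le1 _ v v1).
rewrite -/G sv subnn expr0 mul1r in bx by_ bl.
set q := eps `^ rho in bx by_ bl.
apply: (@le_trans _ _ (q * Num.min 1 (r / eps) / 4 * (act i x + act i y))); last first.
  rewrite ler_wpM2r ?addr_ge0// ler_wpM2r ?invr_ge0//.
  by apply: pow_min; exact: ltW.
have -> : q * Num.min 1 (r / eps) / 4 * (act i x + act i y) =
    Num.min 1 (r / eps) * (q / 4 * (act i x + act i y)) by ring.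
have tri : `|G x - G y| <= q / 4 * (act i x + act i y).
  by apply: (le_trans (ler_normB _ _)); rewrite mulrDr lerD.
have [_|_] := leP 1 (r / eps); first by rewrite mul1r.
(* If neither point is active, both values vanish; otherwise the sum is at least 1 and may multiply
   the Lipschitz bound. *)
have [a0|a1] : act i x + act i y = 0 \/ 1 <= act i x + act i y.
  by rewrite /act; do 2 case: ltP => _; rewrite /= ?mulr0n ?mulr1n;
    by [left; lra|right; lra].
  by move: tri; rewrite a0 !mulr0.
apply: (le_trans bl); rewrite -/r.
have : 0 <= q / 4 / eps * r.
  apply: mulr_ge0; last exact: ltW.
  by do 2 apply: divr_ge0 => //; exact: powR_ge0.
move=> /ler_peMr /(_ a1) /le_trans; apply.
by rewrite le_eqVlt; apply/orP; left; apply/eqP; ring.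
Qed.

End multibump.

(** * Packing the hypercube *)

Section packing.
Context {d : nat}.
Local Notation cube := {ffun 'I_d -> bool}.
Local Open Scope nat_scope.
Implicit Types u v : cube.

Definition hamming u v : nat := \sum_i (u i != v i).

Lemma hammingC u v : hamming u v = hamming v u.
Proof. by apply: eq_bigr => i _; rewrite eq_sym. Qed.

Lemma hamming_xx u : hamming u u = 0.
Proof. by rewrite /hamming big1// => i _; rewrite eqxx. Qed.

(** The weight is a product over the coordinates, each of which contributes [16 + 1]. *)
Lemma sum_hamming_weight v : \sum_u 16 ^ (d - hamming u v) = 17 ^ d.
Proof.
have E u : 16 ^ (d - hamming u v) = \prod_i (if u i == v i then 16 else 1).
  have -> : d - hamming u v = \sum_i (u i == v i).
    have : hamming u v + \sum_i (u i == v i) = d.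
      rewrite -big_split/= -[RHS]card_ord -sum1_card; apply: eq_bigr => i _.
      by case: eqP.
    lia.
  by rewrite expn_sum; apply: eq_bigr => i _; case: eqP.
rewrite (eq_bigr _ (fun u _ => E u)).
rewrite -(bigA_distr_bigA (fun i b => if b == v i then 16 else 1)).
rewrite (eq_bigr (fun=> 17)) ?prod_nat_const ?card_ord// => i _.
by rewrite big_bool/=; case: (v i).
Qed.

(** Exponential Markov bound: every [u] of the ball has weight at least [16 ^ (d - d %/ 16)], out of
    a total of [17 ^ d]. *)
Lemma hamming_ball_card v :
  #|[pred u | 16 * hamming u v <= d]| * 16 ^ (d - d %/ 16) <= 17 ^ d.
Proof.
rewrite -(sum_hamming_weight v) -sum_nat_const.
rewrite [leqRHS](bigID [pred u | 16 * hamming u v <= d])/=.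
apply: leq_trans (leq_addr _ _); apply: leq_sum => u uv.
rewrite leq_pexp2l// leq_sub2l// leq_divRL// mulnC//.
Qed.

(** The balls of radius [d / 16] around a maximal separated set cover the cube, and
    [hamming_ball_card] bounds their size. *)
Lemma gilbert_varshamov : exists S : {set cube},
  (forall u v, u \in S -> v \in S -> u != v -> d < 16 * hamming u v) /\
  2 ^ d <= #|S| ^ 2.
Proof.
pose separated (S : {set cube}) :=
  [forall u in S, forall v in S, (u != v) ==> (d < 16 * hamming u v)].
have sep0 : separated finset.set0 by apply/forall_inP => u; rewrite finset.in_set0.
have [S sepS maxS] := @arg_maxnP _ finset.set0 separated (fun S => #|S|) sep0.
have sepP u v : u \in S -> v \in S -> u != v -> d < 16 * hamming u v.
  by move=> uS vS uv; have /forall_inP/(_ u uS)/forall_inP/(_ v vS)/implyP := sepS; exact.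
exists S; split=> //.
have cover u : exists2 v, v \in S & 16 * hamming u v <= d.
  have [uS|uS] := boolP (u \in S); first by exists u => //; rewrite hamming_xx.
  apply/exists_inP; apply: contraPT (maxS (u |: S)%SET) => /exists_inPn far.
  rewrite cardsU1 uS /= add1n ltnn => /(_ _)/negP; apply => //.
  apply/forall_inP => v; rewrite in_setU1 => /orP[/eqP->|vS];
    apply/forall_inP => w; rewrite in_setU1 => /orP[/eqP->|wS]; apply/implyP => vw.
  - by rewrite eqxx in vw.
  - by rewrite ltnNge; exact: far.
  - by rewrite hammingC ltnNge; exact: far.
  - exact: sepP.
have count : 2 ^ d * 16 ^ (d - d %/ 16) <= #|S| * 17 ^ d.
  apply: (@leq_trans ((\sum_(v in S) #|[pred u | 16 * hamming u v <= d]|) *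
      16 ^ (d - d %/ 16))).
    rewrite leq_mul2r; apply/orP; right.
    have -> : 2 ^ d = \sum_(u : cube) 1.
      by rewrite sum1_card card_ffun card_bool card_ord.
    under [leqRHS]eq_bigr do rewrite -sum1_card big_mkcond.
    rewrite exchange_big/=; apply: leq_sum => u _; have [v vS uv] := cover u.
    by rewrite (bigD1 v)//= inE uv.
  by rewrite big_distrl/= -sum_nat_const; apply: leq_sum => v _; exact: hamming_ball_card.
have k16 : 16 * (d %/ 16) <= d by rewrite mulnC leq_trunc_div.
(* Fourth powers reduce the count to exponents of 2: by [17 ^ 4 <= 2 ^ 17], it remains that
   [2 d + 17 d <= 4 d + 16 (d - d %/ 16)]. *)
have p4 : 4 ^ d * (17 ^ d) ^ 4 <= (2 ^ d * 16 ^ (d - d %/ 16)) ^ 4.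
  have mono a b e : a <= b -> a ^ e <= b ^ e.
    by move=> ab; elim: e => // e IH; rewrite !expnS leq_mul.
  (* [17 ^ 2 = 289 <= 320 = 5 * 2 ^ 6] and [5 ^ 2 <= 2 ^ 5]. *)
  have pow17 : 17 ^ 4 <= 2 ^ 17.
    rewrite (expnM 17 2 2); apply: (@leq_trans ((5 * 2 ^ 6) ^ 2)).
      by rewrite leq_exp2r.
    by rewrite expnMn -expnM (expnD 2 5 12) leq_mul2r; apply/orP; right.
  apply: (@leq_trans (2 ^ (2 * d) * 2 ^ (17 * d))).
    by rewrite -expnM [d * 4]mulnC !expnM leq_mul2l mono ?orbT.
  have pow16 e : 16 ^ e = 2 ^ (4 * e) by rewrite expnM.
  rewrite pow16 -!expnD -expnM (@leq_exp2l 2); last by [].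
  by move: (d %/ 16) k16 => k k16; lia.
have Z0 : 0 < (17 ^ d) ^ 4 by rewrite !expn_gt0.
have : 4 ^ d * (17 ^ d) ^ 4 <= #|S| ^ 4 * (17 ^ d) ^ 4.
  by apply: (leq_trans p4); rewrite -expnMn leq_exp2r.
rewrite (leq_pmul2r Z0) => S4.
by rewrite -(@leq_exp2r _ _ 2)// -!expnM mulnC expnM.
Qed.

End packing.

Section signs.
Context {R : realType} (N : nat).

(** Flipping the sign at [i] alone is an involution that negates the product of the signs at [i] and
    [j], so the cross terms sum to zero. *)
Lemma sum_sign_diff (i j : 'I_N) : i != j ->
  \sum_(s : {ffun 'I_N -> bool}) ((-1) ^+ s i - (-1) ^+ s j) ^+ 2 =
  2 * #|{ffun 'I_N -> bool}|%:R :> R.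
Proof.
move=> ij; pose flip (s : {ffun 'I_N -> bool}) := [ffun k => (k == i) (+) s k].
have flipK : involutive flip.
  by move=> s; apply/ffunP => k; rewrite !ffunE addbA addbb.
pose T : R := \sum_(s : {ffun 'I_N -> bool}) (-1) ^+ s i * (-1) ^+ s j.
have T0 : T = 0.
  have : T = - T.
    rewrite {1}/T (reindex_inj (inv_inj flipK)) -sumrN; apply: eq_bigr => s _.
    by rewrite !ffunE eqxx [j == i]eq_sym (negbTE ij) /= signrN mulNr.
  lra.
transitivity (\sum_(s : {ffun 'I_N -> bool}) (2 - 2 * ((-1) ^+ s i * (-1) ^+ s j) : R)).
  by apply: eq_bigr => s _; rewrite sqrrB !sqrr_sign; ring.
by rewrite sumrB -mulr_sumr -/T T0 mulr0 subr0 sumr_const -[LHS]mulr_natr.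
Qed.

End signs.

(** * Lower bounds *)

Section lower_bounds.
Context {R : realType} (l : nat) (rho M : R).
Hypotheses (rho0 : 0 < rho) (rho1 : rho <= 1) (M0 : 0 < M).

Local Notation m := (2 * l.+2)%N.

Let m0 : 0 < 4 * m%:R ^+ l.+1 :> R.
Proof. by rewrite mulr_gt0// exprn_gt0// ltr0n. Qed.

Lemma ball_bump_center d (eps : R) (theta : 'rV[R]_d) a :
  ball_bump eps theta a theta = eps ^+ (2 * a).
Proof.
rewrite /ball_bump /ball_gap subrr enorm0 expr0n subr0 exprM.
by congr (_ ^+ a); apply/max_idPr; exact: sqr_ge0.
Qed.

Lemma multibump_center d N (eps : R) (theta : 'I_N -> 'rV[R]_d) (c : 'I_N -> R) i :
  0 < eps -> (forall i j, i != j -> 2 * eps <= enorm (theta i - theta j)) ->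
  multibump N l eps theta c (theta i) = c i * eps ^+ m.
Proof.
move=> eps0 sep; rewrite /multibump fct_sumE (bigD1 i)//= big1 ?addr0.
  by rewrite fctE ball_bump_center.
move=> j ji; rewrite fctE.
have /(bump_class_bound _ _ eps0 l.+1 _ _ _ (theta i)) :=
  bump_class_bump eps (theta j) l.+2 l.+2 (leqnn _).
have /negbTE -> : ~~ (enorm (theta i - theta j) < eps).
  by rewrite -leNgt enormB_sym; have := sep j i ji; lra.
by rewrite mulr0 normr_le0 => /eqP ->; rewrite scaler0.
Qed.

(* [r ^ 2 <= D / (5 n M)] keeps [n] observations at distance [r] uninformative. *)
Lemma radius_exists (n D : nat) : (0 < n)%N -> (0 < D)%N ->
  exists2 r : R, 0 < r <= 1 & n%:R * (M * r ^+ 2) <= D%:R / 5 /\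
    Num.min 1 (Num.sqrt (5 * M))^-1 * Num.min 1 (Num.sqrt (D%:R / n%:R)) <= r.
Proof.
move=> n0 D0; have n0' : 0 < n%:R :> R by rewrite ltr0n.
have D0' : 0 < D%:R :> R by rewrite ltr0n.
pose t : R := Num.sqrt (5 * M); pose q : R := Num.sqrt (D%:R / n%:R).
have t0 : 0 < t by rewrite sqrtr_gt0 mulr_gt0.
have q0 : 0 < q by rewrite sqrtr_gt0 divr_gt0.
have tE : t ^+ 2 = 5 * M by rewrite sqr_sqrtr// mulr_ge0// ltW.
have qE : q ^+ 2 = D%:R / n%:R by rewrite sqr_sqrtr// divr_ge0// ltW.
exists (Num.min 1 (t^-1 * q)); last split.
- by rewrite lt_min ltr01 mulr_gt0 ?invr_gt0// ge_min lexx.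
- apply: (@le_trans _ _ (n%:R * (M * (t^-1 * q) ^+ 2))).
    rewrite ler_wpM2l// ler_wpM2l ?(ltW M0)// lerXn2r ?nnegrE//.
    + by rewrite le_min ler01 mulr_ge0 ?invr_ge0 ?(ltW t0) ?(ltW q0).
    + by rewrite mulr_ge0 ?invr_ge0 ?(ltW t0) ?(ltW q0).
    + by rewrite ge_min lexx orbT.
  rewrite exprMn exprVn tE qE le_eqVlt; apply/orP; left; apply/eqP.
  by field; rewrite !gt_eqF.
- have a0 : 0 <= Num.min 1 t^-1 by rewrite le_min ler01 invr_ge0 ltW.
  have b0 : 0 <= Num.min 1 q by rewrite le_min ler01 ltW.
  rewrite le_min -[X in _ <= X]mulr1; apply/andP; split; apply: ler_pM => //;
    by rewrite ge_min lexx ?orbT.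
Qed.

Section model.
Context (n d : nat) (V : 'rV[R]_d -> R).
Hypotheses (n0 : (0 < n)%N) (d0 : (0 < d)%N).
Hypothesis V1 : (\int[lebesgue_rV d]_x (expR (- V x))%:E = 1)%E.
Hypothesis dV : ndifferentiable 2 V.
Hypothesis HM :
  (ereal_sup [set mx_opnorm (hessian V x) | x in [set: 'rV[R]_d]] <= M%:E)%E.

Local Notation c0 := (Num.min 1 (Num.sqrt (5 * M))^-1 : R).
Local Notation sup_risk := (ereal_sup [set minimax_risk n V f | f in holder_ball l rho]).

(** The packing is a separated set of hypercube vertices scaled by [a = r / sqrt d]: its points have
    norm at most [r] and squared distances at least [r ^ 2 / 16]. The functions are indexed by sign
    patterns, and [theta_0 = 0]. *)
Lemma packing_lower_bound :
  (((c0 / 8 * Num.min 1 (Num.sqrt (d%:R / n%:R))) `^ (l%:R + rho) /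
     (4 * m%:R ^+ l.+1) / 34)%:E <= sup_risk)%E.
Proof.
have [r /andP[r0 r1] [nr cr]] := radius_exists n d n0 d0.
have d0' : 0 < d%:R :> R by rewrite ltr0n.
have [S [Ssep Scard]] := @gilbert_varshamov d.
pose a : R := r / Num.sqrt d%:R.
have sd0 : 0 < Num.sqrt d%:R :> R by rewrite sqrtr_gt0.
have a0 : 0 < a by rewrite divr_gt0.
have aE : a ^+ 2 * d%:R = r ^+ 2.
  by rewrite exprMn exprVn sqr_sqrtr ?ltW// mulfVK// gt_eqF.
pose theta (i : 'I_#|S|) : 'rV[R]_d := \row_j (a * (enum_val i j : nat)%:R).
have dist i j : enorm (theta i - theta j) ^+ 2 =
    a ^+ 2 * (hamming (enum_val i) (enum_val j))%:R.
  rewrite enorm_sqr /hamming natr_sum mulr_sumr; apply: eq_bigr => k _.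
  rewrite !mxE -mulrBr exprMn; congr (_ * _).
  by case: (enum_val i k); case: (enum_val j k);
    rewrite /= ?subrr ?subr0 ?sub0r ?sqrrN ?expr0n ?expr1n.
have theta_le i : enorm (theta i) <= r.
  rewrite -(ler_pXn2r (n := 2))// ?nnegrE ?enorm_ge0 ?(ltW r0)//.
  rewrite enorm_sqr -aE -[X in _ <= _ * X%:R]card_ord -sum1_card natr_sum mulr_sumr.
  apply: ler_sum => k _; rewrite mxE exprMn ler_wpM2l ?sqr_ge0//.
  by case: (enum_val i k); rewrite /= ?expr1n ?expr0n ?ler01.
(* [2 * eps = r / 4] is the separation of the packing, so the balls are disjoint. *)
pose eps := r / 8.
have eps0 : 0 < eps by rewrite divr_gt0.
have eps1 : eps <= 1 by rewrite /eps; lra.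
have sep i j : i != j -> 2 * eps <= enorm (theta i - theta j).
  move=> ij; rewrite -(ler_pXn2r (n := 2))// ?nnegrE ?enorm_ge0 ?mulr_ge0 ?(ltW eps0) ?(ltW r0)//.
  rewrite dist.
  have : (d < 16 * hamming (enum_val i) (enum_val j))%N.
    apply: Ssep; rewrite ?enum_valP//; apply: contra ij => /eqP e.
    by apply/eqP; exact: enum_val_inj.
  rewrite -(ltr_nat R) natrM => /ltW /(ler_wpM2l (sqr_ge0 a)); rewrite aE.
  by rewrite /eps => H; rewrite (_ : (2 * (r / 8)) ^+ 2 = r ^+ 2 / 16); [lra|field].
pose kap := bump_scale l rho eps.
have kap0 : 0 < kap.
  by rewrite /kap /bump_scale !divr_gt0 ?powR_gt0 ?exprn_gt0.
pose c (s : {ffun 'I_#|S| -> bool}) i := (-1) ^+ s i * kap.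
pose f s := multibump #|S| l eps theta (c s).
have fball s : holder_ball l rho (f s).
  apply: (multibump_holder_ball _ _ _ _ _ _ rho0 rho1 eps0 eps1 sep) => i.
  by rewrite /c normrM normr_sign mul1r ger0_norm// ltW.
have fE s i : f s (theta i) = (-1) ^+ s i * (kap * eps ^+ m).
  by rewrite /f (multibump_center _ _ _ _ _ _ eps0 sep) /c -mulrA.
(* The height of the bumps at their centres, of order [eps ^ s]. *)
pose v := kap * eps ^+ m.
have v0 : 0 < v by rewrite mulr_gt0 ?exprn_gt0.
have vE : v = eps `^ (l%:R + rho) / (4 * m%:R ^+ l.+1).
  by rewrite /v /kap /bump_scale; field; rewrite !gt_eqF ?exprn_gt0 ?ltr0n.
(* Over all sign patterns the squared difference averages to [2 v ^ 2], above the required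
   [4 (v / 2) ^ 2]. The denominator 34 is [2 * 17]. *)
apply: le_trans (minimax_lower_bound n d M (v / 2) V _ _ theta 0 _ f
   V1 dV HM (ltW M0) d0 _ _ _ _ _ fball _).
- rewrite lee_fin (_ : v / 2 / 17 = v / 34); last by field.
  rewrite ler_wpM2r ?invr_ge0// vE ler_wpM2r ?invr_ge0 ?(ltW m0)//.
  have l0 : 0 <= l%:R + rho by rewrite addr_ge0// ltW.
  have le_eps : c0 / 8 * Num.min 1 (Num.sqrt (d%:R / n%:R)) <= eps.
    by rewrite /eps mulrAC ler_wpM2r ?invr_ge0.
  apply: ge0_ler_powR => //; rewrite nnegrE ?(ltW eps0)//.
- by rewrite card_ord -!natrX ler_nat.
- by rewrite divr_gt0.
- by move=> i; exact: le_trans (theta_le i) r1.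
- move=> i; rewrite subr0; apply: le_trans nr.
  rewrite ler_wpM2l// ler_wpM2l ?(ltW M0)// lerXn2r ?nnegrE ?enorm_ge0 ?(ltW r0)//.
- by rewrite card_ffun card_bool card_ord expn_gt0.
- move=> i j ij.
  rewrite (eq_bigr (fun s : {ffun 'I_#|S| -> bool} =>
     v ^+ 2 * ((-1) ^+ s i - (-1) ^+ s j) ^+ 2)); last first.
    by move=> s _; rewrite !fE -/v -mulrBl exprMn mulrC.
  rewrite -mulr_sumr sum_sign_diff//.
  have : 0 <= v ^+ 2 * #|{ffun 'I_#|S| -> bool}|%:R by rewrite mulr_ge0 ?sqr_ge0.
  rewrite (_ : 4 * (v / 2) ^+ 2 = v ^+ 2); last by field.
  by rewrite mulrCA; lra.
Qed.

(** Two points at distance [r / 2] lie on the slope of a unit bump centred at 0. With [D = 1] the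
    cardinality condition reads [2 <= 4], and the only function is indexed by [unit]. The point
    [theta false] doubles as [theta_0]. *)
Lemma two_point_lower_bound :
  ((c0 * Num.min 1 (Num.sqrt n%:R)^-1 * (3 / 4) ^+ l.+1 /
     (4 * m%:R ^+ l.+1) / 68)%:E <= sup_risk)%E.
Proof.
have [r /andP[r0 r1] [nr cr]] := radius_exists n 1 n0 isT.
pose e : 'rV[R]_d := delta_mx ord0 (Ordinal d0).
have e1 : enorm e = 1.
  rewrite /enorm (bigD1 (Ordinal d0))//= big1 ?addr0.
    by rewrite mxE !eqxx expr1n sqrtr1.
  by move=> i ne; rewrite mxE (negbTE ne) andbF expr0n.
(* Both points stay in [[1 / 2, 1]], where the bump decreases strictly. *)
pose p (b : bool) : R := if b then 2^-1 + r / 2 else 2^-1.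
pose theta b := p b *: e.
have p01 b : 0 <= p b <= 1 by rewrite /p; case: b; apply/andP; split; lra.
have theta_norm b : enorm (theta b) = p b.
  by rewrite enormZ e1 mulr1 ger0_norm//; case/andP: (p01 b).
pose kap := bump_scale l rho (1 : R).
have kapE : kap = (4 * m%:R ^+ l.+1)^-1.
  by rewrite /kap /bump_scale powR1 expr1n divr1 mul1r.
have kap0 : 0 < kap by rewrite kapE invr_gt0.
pose f := multibump 1 l (1 : R) (fun=> 0 : 'rV[R]_d) (fun=> kap).
have fball : holder_ball l rho f.
  apply: multibump_holder_ball => // [i j|i]; first by rewrite !ord1.
  by rewrite ger0_norm// ltW.
have fE b : f (theta b) = kap * (1 - p b ^+ 2) ^+ l.+2.
  rewrite /f /multibump fct_sumE big_ord1 fctE; congr (_ * _).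
  rewrite /ball_bump /ball_gap subr0 theta_norm expr1n; congr (_ ^+ _).
  apply/max_idPr; rewrite subr_ge0 -[leRHS](expr1n _ 2).
  by case/andP: (p01 b) => *; rewrite lerXn2r ?nnegrE.
(* This 4 and the 17 of [minimax_lower_bound] make up the denominator 68. *)
pose eta := kap * (r / 4) * (3 / 4) ^+ l.+1.
have q0 : 0 < (3 / 4 : R) ^+ l.+1 by rewrite exprn_gt0//; lra.
have eta0 : 0 < eta by rewrite !mulr_gt0//; lra.
(* One factor of the power [B ^ (l + 2)] provides the drop [r / 2]; the others stay below
   [3 / 4]. *)
have diff : 2 * eta <= f (theta false) - f (theta true).
  rewrite !fE -mulrBr /eta.
  pose B : R := 1 - p true ^+ 2.
  have B0 : 0 <= B by rewrite /B /p expr2; nra.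
  have BA : B <= 3 / 4 - r / 2 by rewrite /B /p expr2; nra.
  have -> : 1 - p false ^+ 2 = 3 / 4 by rewrite /p; field.
  have Bk : B ^+ l.+1 <= (3 / 4) ^+ l.+1.
    by rewrite lerXn2r ?nnegrE//; lra.
  have : B ^+ l.+2 <= (3 / 4 - r / 2) * (3 / 4) ^+ l.+1.
    by rewrite exprS; apply: ler_pM => //; exact: exprn_ge0.
  rewrite -/B [(3 / 4) ^+ l.+2]exprS => H.
  rewrite (_ : 2 * (kap * (r / 4) * (3 / 4) ^+ l.+1) =
     kap * (r / 2 * (3 / 4) ^+ l.+1)); last by field.
  by rewrite ler_wpM2l ?(ltW kap0)//; lra.
apply: le_trans (minimax_lower_bound n 1 M eta V _ _ theta (theta false) _
   (fun _ : unit => f) V1 dV HM (ltW M0) isT _ eta0 _ _ _ _ _).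
- rewrite lee_fin /eta kapE.
  rewrite div1r sqrtrV ?ler0n// in cr.
  set Q := (3 / 4) ^+ l.+1 in q0 *; set K := (_ * _)^-1.
  have K0 : 0 < K by rewrite /K invr_gt0.
  rewrite (_ : K * (r / 4) * Q / 17 = r * (Q * K / 68)); last by field.
  rewrite -[_ * Q / _ / _]mulrA -mulrA -mulrA ler_wpM2r//.
  by rewrite !mulr_ge0// ltW.
- by rewrite card_bool expr1 expr2; lra.
- by move=> b; rewrite theta_norm; case/andP: (p01 b).
- move=> b; apply: le_trans nr; rewrite ler_wpM2l// ler_wpM2l ?(ltW M0)//.
  rewrite /theta -scalerBl enormZ e1 mulr1 lerXn2r ?nnegrE ?(ltW r0)//.
  by rewrite /p; case: b; rewrite ?subrr ?normr0 ?(ltW r0)// addrC addKr ger0_norm; lra.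
- by rewrite card_unit.
- by [].
- have sq : (2 * eta) ^+ 2 <= (f (theta false) - f (theta true)) ^+ 2.
    by rewrite lerXn2r ?nnegrE//; lra.
  by move=> [] [] // _; rewrite card_unit big_const card_unit /= addr0;
    rewrite mulr1 ?(sqrrB (f (theta true))) ; move: sq; rewrite !expr2; lra.
Qed.

End model.
End lower_bounds.

(** Truncation at 1 commutes with the maximum, so each of the two lower bounds handles one of its
    arguments. The constants [C1] and [C2] are fixed before [n], [d], [L] and [V]. *)
Theorem proposition2p2 (R : realType) (m M : R) (hm : 0 < m) (hM : 0 < M)
    (s : R) (l : nat) (rho : R) (hrho0 : 0 < rho) (hrho1 : rho <= 1)
    (hs : s = l%:R + rho) :
  exists C : R, 0 < C /\
    forall (n d : nat) (L : R) (V : 'rV[R]_d -> R),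
      (1 <= n)%N -> (1 <= d)%N -> 0 < L ->
      location_model V -> assumption1 M L m V ->
      ((C * Num.min
              (Num.max (Num.sqrt n%:R)^-1 (Num.sqrt (d%:R / n%:R) `^ s)) 1)%:E
       <= ereal_sup [set minimax_risk n V f | f in holder_ball l rho])%E.
Proof.
pose c0 : R := Num.min 1 (Num.sqrt (5 * M))^-1.
have c00 : 0 < c0 by rewrite lt_min ltr01 invr_gt0 sqrtr_gt0 mulr_gt0.
pose K : R := 4 * (2 * l.+2)%:R ^+ l.+1.
have K0 : 0 < K by rewrite mulr_gt0// exprn_gt0// ltr0n.
pose C1 := (c0 / 8) `^ s / K / 34.
pose C2 := c0 * (3 / 4) ^+ l.+1 / K / 68.
have C10 : 0 < C1.
  by do 2 apply: divr_gt0 => //; apply: powR_gt0; exact: divr_gt0.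
have C20 : 0 < C2.
  by do 2 apply: divr_gt0 => //; apply: mulr_gt0 => //; apply: exprn_gt0; lra.
exists (Num.min C1 C2); split; first by rewrite lt_min C10.
move=> n d L V n1 d1 _ [_ V1] [_ [dV _] HM _ _].
have s0 : 0 <= s by rewrite hs addr_ge0// ltW.
have pack := packing_lower_bound l rho M hrho0 hrho1 hM n d V n1 d1 V1 dV HM.
have two := two_point_lower_bound l rho M hrho0 hrho1 hM n d V n1 d1 V1 dV HM.
set q := Num.sqrt (d%:R / n%:R) in pack *.
have q0 : 0 <= q by exact: sqrtr_ge0.
have C0 : 0 < Num.min C1 C2 by rewrite lt_min C10.
have maxP : Num.min (Num.max (Num.sqrt n%:R)^-1 (q `^ s)) 1 =
    Num.max (Num.min 1 (Num.sqrt n%:R)^-1) (Num.min 1 (q `^ s)).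
  by rewrite minC min_maxr.
rewrite maxP maxr_pMr ?(ltW C0)// EFin_max ge_max; apply/andP; split.
  apply: le_trans two; rewrite lee_fin.
  apply: (@le_trans _ _ (C2 * Num.min 1 (Num.sqrt n%:R)^-1)).
    by rewrite ler_wpM2r ?le_min ?ler01 ?invr_ge0 ?sqrtr_ge0// ge_min lexx orbT.
  by rewrite /C2 le_eqVlt; apply/orP; left; apply/eqP; rewrite -/c0 -/K; field; rewrite gt_eqF.
apply: le_trans pack; rewrite lee_fin.
apply: (@le_trans _ _ (C1 * Num.min 1 (q `^ s))).
  by rewrite ler_wpM2r ?le_min ?ler01 ?powR_ge0// ge_min lexx.
have qmin : Num.min 1 (q `^ s) <= Num.min 1 q `^ s.
  have [q1|q1] := leP 1 q; first by rewrite powR1 ge_min lexx.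
  by rewrite ge_min lexx orbT.
rewrite -hs -/c0 -/K powRM ?divr_ge0 ?(ltW c00)//; last by rewrite le_min ler01.
have -> : (c0 / 8) `^ s * Num.min 1 q `^ s / K / 34 = C1 * Num.min 1 q `^ s.
  by rewrite [RHS]mulrC /C1 !mulrA; congr (_ / K / 34); exact: mulrC.
by rewrite ler_wpM2l// ltW.
Qed.
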